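(* Let $k\ge 1$, let $\mathcal H\subseteq \mathrm{FIN}_k^{\infty}$ be a semiselective coideal, and let $\mathbb P$ be the family of perfect subsets of $2^{\infty}$. Then: (a) a set $\mathcal X\subseteq 2^{\infty}\times \mathrm{FIN}_k^{\infty}$ is perfectly $\mathcal H$-Ramsey if and only if $\mathcal X$ has the $\mathbb P\times \mathrm{Exp}(\mathcal H)$-Baire property; (b) a set $\mathcal X\subseteq 2^{\infty}\times \mathrm{FIN}_k^{\infty}$ is perfectly $\mathcal H$-Ramsey null if and only if $\mathcal X$ is $\mathbb P\times \mathrm{Exp}(\mathcal H)$-meager.
   Context: Fix a positive integer $k$. $\mathrm{FIN}_k$ is the set of functions $p:\mathbb N\to\{0,\dots,k\}$ with $\mathrm{supp}(p)=\{n:p(n)\neq 0\}$ finite and $k$ in the range of $p$. Write $p<q$ if $\max\mathrm{supp}(p)<\min\mathrm{supp}(q)$. A block sequence is a (finite or infinite) sequence $(p_n)$ in $\mathrm{FIN}_k$ with $p_n<p_{n+1}$ for all $n$; $\mathrm{FIN}_k^{\infty}$ (resp. $\mathrm{FIN}_k^{<\infty}$) is the set of infinite (resp. finite, including empty) block sequences, and $\mathrm{FIN}_k^{[d]}$ those of length $d$. Let $T(p)(n)=\max\{p(n)-1,0\}$, $T^{(0)}=\mathrm{id}$. For a block sequence $A=(p_n)$, $[A]$ is the set of all elements of $\mathrm{FIN}_k$ of the form $T^{(i_0)}(p_{n_0})+\dots+T^{(i_l)}(p_{n_l})$ with $n_0<\dots<n_l$, $i_j\in\{0,\dots,k\}$,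 at least one $i_j=0$. For block sequences, $X\le Y$ means every element of $X$ is in $[Y]$. $r_n(A)$ is the sequence of the first $n$ elements of $A$; $|a|$ is the length of $a$; $a\sqsubseteq b$ means $a$ is an initial segment of $b$. For $a\in\mathrm{FIN}_k^{<\infty}$, $A\in \mathrm{FIN}_k^{\infty}$: $[a,A]=\{B\in\mathrm{FIN}_k^\infty:\exists n\ r_n(B)=a,\ B\le A\}$; $[n,A]=[r_n(A),A]$; $r_n[a,A]=\{r_n(B):B\in[a,A]\}$; $\mathrm{FIN}_k^{<\infty}\upharpoonright A=\{a:[a,A]\neq\emptyset\}$; $\mathrm{depth}_A(a)=\min\{n:a\le r_n(A)\}$. For $\mathcal H\subseteq \mathrm{FIN}_k^\infty$, $\mathcal H\upharpoonright A=\{B\in\mathcal H:B\le A\}$. A coideal is $\mathcal H\subseteq\mathrm{FIN}_k^\infty$ such that: (a) if $A\in\mathcal H$ and $B\in\mathrm{FIN}_k^\infty$ has finite symmetric difference with $A$ (as sets of blocks) then $B\in\mathcal H$; (b) $A\in\mathcal H$, $A\le B$ imply $B\in\mathcal H$; (c) for all $A\in\mathcal H$ and $a\in \mathrm{FIN}_k^{<\infty}\upharpoonright A$: $[a,B]\ne\emptyset$ for all $B\in[\mathrm{depth}_A(a),A]\cap\mathcal H$, and if $B\in\mathcal H\upharpoonright A$ with $[a,B]\neq\emptyset$ then there is $A'\in[\mathrm{depth}_A(a),A]\cap\mathcal H$ with $\emptyset\ne[a,A']\subseteq[a,B]$; (d) for all $A\in\mathcal H$, $a\in\mathrm{FIN}_k^{<\infty}\upharpoonright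 A$ and $\mathcal O\subseteq \mathrm{FIN}_k^{[|a|+1]}$ there is $B\in[\mathrm{depth}_A(a),A]\cap\mathcal H$ with $r_{|a|+1}[a,B]\subseteq\mathcal O$ or $r_{|a|+1}[a,B]\cap\mathcal O=\emptyset$. For $\mathcal D,\mathcal S\subseteq\mathcal H$, $\mathcal D$ is dense open in $\mathcal S$ if every $A\in\mathcal S$ has some $B\in\mathcal D$ with $B\le A$, and $A\in\mathcal S$, $B\in\mathcal D$, $A\le B$ imply $A\in\mathcal D$. A coideal $\mathcal H$ is semiselective if for every $A\in\mathcal H$, every family $(\mathcal D_a)_{a\in\mathrm{FIN}_k^{<\infty}\upharpoonright A}$ with each $\mathcal D_a$ dense open in $\mathcal H\cap[\mathrm{depth}_A(a),A]$, and every $C\in\mathcal H\upharpoonright A$, there is $B\in\mathcal H\upharpoonright C$ and a family $(A_a)$ with $A_a\in\mathcal D_a$ such that $[a,B]\subseteq[a,A_a]$ for all $a\in \mathrm{FIN}_k^{<\infty}\upharpoonright B$. $2^\infty$ has the product topology. A set $\mathcal X\subseteq 2^\infty\times\mathrm{FIN}_k^\infty$ is perfectly $\mathcal H$-Ramsey if for every perfect $Q\subseteq 2^\infty$ and every $[a,A]\neq\emptyset$ with $A\in\mathcal H$ there are a perfect $S\subseteq Q$ and $B\in[a,A]\cap\mathcal H$ with $S\times[a,B]\subseteq\mathcal X$ or $(S\times[a,B])\cap\mathcal X=\emptyset$; it is perfectly $\mathcal H$-Ramsey null if always the second alternative can be obtained. $\mathcal X$ has the $\mathbb P\times\mathrm{Exp}(\mathcal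 H)$-Baire property if for every perfect $Q$ and every $[a,A]\ne\emptyset$ with $A\in\mathcal H$ there are a perfect $S\subseteq Q$ and a nonempty $[b,B]\subseteq[a,A]$ with $B\in\mathcal H$ such that $S\times[b,B]\subseteq\mathcal X$ or $(S\times[b,B])\cap\mathcal X=\emptyset$; it is $\mathbb P\times\mathrm{Exp}(\mathcal H)$-meager if always the second alternative can be obtained. *)

(* Defs.v *)
From mathcomp Require Import all_boot.
From mathcomp Require Import boolp classical_sets functions cardinality.
From mathcomp Require Import topology cantor.

Set Implicit Arguments.
Unset Strict Implicit.
Unset Printing Implicit Defensive.

Local Open Scope classical_set_scope.
Local Open Scope nat_scope.

(* Elements of FIN_k are plain functions [nat -> nat] satisfying [FIN k];
   finite block sequences are lists satisfying [FINfin k]; infinite block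
   sequences are functions satisfying [FINinf k]. *)
Notation elt := (nat -> nat).
Notation fseq := (seq (nat -> nat)).
Notation iseq := (nat -> nat -> nat).

Definition elt0 : elt := fun=> 0.

Definition supp (p : elt) : set nat := [set n | p n != 0].

Definition FIN (k : nat) : set elt :=
  [set p | [/\ forall n, p n <= k, finite_set (supp p) & exists n, p n = k]].

(* On the nonempty finite supports of elements of FIN_k (k >= 1) this says
   max (supp p) < min (supp q). *)
Definition elt_lt (p q : elt) : Prop :=
  forall m n, supp p m -> supp q n -> m < n.

(* Truncated subtraction: this is max (p n - 1) 0. *)
Definition tetris (p : elt) : elt := fun n => p n - 1.

(* Finite and infinite sequences are treated uniformly as functions restricted
   to an index set I: I = `I_(size a) for a finite a, I = setT for an infinite
   sequence. *)
Definition blocks (k : nat) (I : set nat) (p : iseq) : Prop :=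
  (forall n, I n -> FIN k (p n)) /\
  (forall n, I n -> I n.+1 -> elt_lt (p n) (p n.+1)).

(* The exponent of T at the block of index j is (e j); s lists the indices
   n_0 < ... < n_l. *)
Definition comb (k : nat) (I : set nat) (p : iseq) : set elt :=
  [set q | FIN k q /\ exists (s : seq nat) (e : nat -> nat),
    [/\ sorted ltn s,
        forall j, j \in s -> I j,
        forall j, j \in s -> e j <= k,
        exists2 j, j \in s & e j = 0 &
        q = fun m => \sum_(j <- s) iter (e j) tetris (p j) m]].

Definition fnth (a : fseq) : iseq := nth elt0 a.

Definition FINfin (k : nat) : set fseq :=
  [set a | blocks k `I_(size a) (fnth a)].

Definition FINlen (k d : nat) : set fseq := [set a | FINfin k a /\ size a = d].

Definition FINinf (k : nat) : set iseq := [set A | blocks k setT A].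

Definition fspan (k : nat) (a : fseq) : set elt := comb k `I_(size a) (fnth a).

Definition ispan (k : nat) (A : iseq) : set elt := comb k setT A.

Definition fle (k : nat) (a b : fseq) : Prop :=
  forall n, n < size a -> fspan k b (fnth a n).

Definition ile (k : nat) (A B : iseq) : Prop := forall n, ispan k B (A n).

Definition restr (n : nat) (A : iseq) : fseq := mkseq A n.

Definition basic (k : nat) (a : fseq) (A : iseq) : set iseq :=
  [set B | [/\ FINinf k B, exists n, restr n B = a & ile k B A]].

Definition basicn (k n : nat) (A : iseq) : set iseq := basic k (restr n A) A.

Definition FINbelow (k : nat) (A : iseq) : set fseq :=
  [set a | FINfin k a /\ basic k a A !=set0].

(* The least n with a <= r_n(A); the default 0 is only used when there is no
   such n, which does not happen for a in FINbelow k A. *)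
Definition depth (k : nat) (A : iseq) (a : fseq) : nat :=
  xget 0 [set n | fle k a (restr n A) /\
                  forall m, fle k a (restr m A) -> n <= m].

Definition below (k : nat) (H : set iseq) (A : iseq) : set iseq :=
  [set B | H B /\ ile k B A].

Record coideal (k : nat) (H : set iseq) : Prop := Coideal {
  coideal_sub : H `<=` FINinf k ;
  coideal_fin : forall A B, H A -> FINinf k B ->
    finite_set (range A `+` range B) -> H B ;
  coideal_up : forall A B, H A -> FINinf k B -> ile k A B -> H B ;
  coideal_nonempty : forall A a, H A -> FINbelow k A a ->
    forall B, (basicn k (depth k A a) A `&` H) B -> basic k a B !=set0 ;
  coideal_amalg : forall A a, H A -> FINbelow k A a ->
    forall B, below k H A B -> basic k a B !=set0 ->
    exists A', [/\ (basicn k (depth k A a) A `&` H) A',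
                   basic k a A' !=set0 &
                   basic k a A' `<=` basic k a B] ;
  coideal_pigeonhole : forall A a, H A -> FINbelow k A a ->
    forall O : set fseq, O `<=` FINlen k (size a).+1 ->
    exists2 B, (basicn k (depth k A a) A `&` H) B &
      restr (size a).+1 @` basic k a B `<=` O \/
      restr (size a).+1 @` basic k a B `&` O = set0 }.

(* D is a dense open SUBSET of S.  The inclusion must not be relaxed to D being
   a subset of the ambient coideal: for S = H `&` [depth_A(a), A], a family D_a
   of sequences lying entirely after the first depth_A(a) blocks of A would then
   be dense open in S, and no nonempty coideal would be semiselective. *)
Definition dense_open (k : nat) (D S : set iseq) : Prop :=
  [/\ D `<=` S,
      forall A, S A -> exists2 B, D B & ile k B A &
      forall A B, S A -> D B -> ile k A B -> D A].

Definition semiselective (k : nat) (H : set iseq) : Prop :=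
  forall A, H A ->
  forall D : fseq -> set iseq,
    (forall a, FINbelow k A a ->
       dense_open k (D a) (H `&` basicn k (depth k A a) A)) ->
  forall C, below k H A C ->
  exists B (F : fseq -> iseq),
    [/\ below k H C B,
        forall a, FINbelow k A a -> D a (F a) &
        forall a, FINbelow k B a -> basic k a B `<=` basic k a (F a)].

(* [perfect_set] holds of the empty set, which is excluded here. *)
Definition perfect (Q : set cantor_space) : Prop := perfect_set Q /\ Q !=set0.

Definition pramsey (k : nat) (H : set iseq)
    (X : set (cantor_space * iseq)) : Prop :=
  forall Q a A, perfect Q -> FINfin k a -> H A -> basic k a A !=set0 ->
  exists S B, [/\ perfect S, S `<=` Q, (basic k a A `&` H) B &
    S `*` basic k a B `<=` X \/ (S `*` basic k a B) `&` X = set0].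

Definition pramsey_null (k : nat) (H : set iseq)
    (X : set (cantor_space * iseq)) : Prop :=
  forall Q a A, perfect Q -> FINfin k a -> H A -> basic k a A !=set0 ->
  exists S B, [/\ perfect S, S `<=` Q, (basic k a A `&` H) B &
    (S `*` basic k a B) `&` X = set0].

Definition pbaire (k : nat) (H : set iseq)
    (X : set (cantor_space * iseq)) : Prop :=
  forall Q a A, perfect Q -> FINfin k a -> H A -> basic k a A !=set0 ->
  exists S b B, [/\ perfect S /\ S `<=` Q, FINfin k b /\ H B,
    basic k b B !=set0, basic k b B `<=` basic k a A &
    S `*` basic k b B `<=` X \/ (S `*` basic k b B) `&` X = set0].

Definition pmeager (k : nat) (H : set iseq)
    (X : set (cantor_space * iseq)) : Prop :=
  forall Q a A, perfect Q -> FINfin k a -> H A -> basic k a A !=set0 ->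
  exists S b B, [/\ perfect S /\ S `<=` Q, FINfin k b /\ H B,
    basic k b B !=set0, basic k b B `<=` basic k a A &
    (S `*` basic k b B) `&` X = set0].

(* Main.v *)
(* Only Baire => Ramsey needs work.  Say that (P, i, D) accepts X if
   P x [r_i(D), D] lies in X, and that it rejects X if no smaller perfect set and
   no smaller condition of H with the same first i blocks accepts.  The heart of
   the proof is a fusion that, below any (P, A), yields a perfect S and B in H
   such that S either accepts X with A's stem or rejects X with every stem
   extending it.  Applying this to X and to its complement, the case where both
   are rejected everywhere contradicts the Baire property.

   Two difficulties are specific to this setting.
   - H is not an ultrafilter and the dense sets in the definition of
     semiselectivity are fixed in advance, whereas a fusion chooses its perfect
     sets along the way.  The chosen perfect sets are therefore treated as names:
     always taking the least possible choice for a well-ordering makes it depend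
     only on the condition, and compatible conditions make the same choices.
   - If (P, c, C) rejects, some smaller condition must reject every one-block
     extension of c at once.  This needs a pigeonhole principle with a perfect set
     of parameters: a colour of the one-block extensions that is homogeneous for
     densely many single points x is made homogeneous on a perfect set by a fusion
     that keeps finitely many such points at each stage. *)

Require Import Defs.
From mathcomp Require Import all_boot.
From mathcomp Require Import boolp classical_sets functions cardinality wochoice.
From mathcomp Require Import topology cantor.
From mathcomp Require Import zify.

Set Implicit Arguments.
Unset Strict Implicit.
Unset Printing Implicit Defensive.

Local Open Scope classical_set_scope.
Local Open Scope nat_scope.

(** * Spans and exponent functions *)

Section Spans.
Variables (k : nat) (hk : 0 < k).
Implicit Types (p q : elt) (A B C D : iseq) (I J : set nat).

(* [e j] is the exponent of T at the block A j; the blocks with [k <= e j] do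
   not occur, since T^(k) kills them. *)
Definition rep A (e : nat -> nat) q : Prop :=
  [/\ FIN k q, forall j m, A j m != 0 -> q m = A j m - e j &
      forall m, q m != 0 -> exists j, A j m != 0].

Definition spanJ A J q : Prop :=
  exists2 e, rep A e q & forall j, e j < k -> J j.

Lemma FINinf_FIN A j : FINinf k A -> FIN k (A j).
Proof. by case=> h _; exact: h. Qed.

Lemma FIN_top q : FIN k q -> exists2 m, q m = k & q m != 0.
Proof. by case=> _ _ [m hm]; exists m; rewrite hm // -lt0n. Qed.

Lemma FIN_bound q : FIN k q -> exists M, forall m, q m != 0 -> m < M.
Proof.
case=> _ /finite_seqP [s hs] _; exists (\max_(i <- s) i).+1 => m hm.
have : [set` s] m by rewrite -hs.
by move=> /= ms; rewrite ltnS; exact: leq_bigmax_seq.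
Qed.

Lemma elt_lt_trans p q r : FIN k q -> elt_lt p q -> elt_lt q r -> elt_lt p r.
Proof.
move=> /FIN_top [t _ ht] pq qr m n hm hn.
exact: ltn_trans (pq _ _ hm ht) (qr _ _ ht hn).
Qed.

Lemma blocks_lt A i j : FINinf k A -> i < j -> elt_lt (A i) (A j).
Proof.
move=> [hF hA]; elim: j => // j IH; rewrite ltnS leq_eqVlt => /orP[/eqP ->|/IH h].
  exact: hA.
by apply: elt_lt_trans h _; [exact: hF|exact: hA].
Qed.

Lemma blocks_inj A i j m : FINinf k A -> A i m != 0 -> A j m != 0 -> i = j.
Proof.
move=> hA hi hj; case: (ltngtP i j) => // h.
  by have := blocks_lt hA h hi hj; rewrite ltnn.
by have := blocks_lt hA h hj hi; rewrite ltnn.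
Qed.

Lemma blocks_geq A j m : FINinf k A -> A j m != 0 -> j <= m.
Proof.
move=> hA; elim: j m => // j IH m hm.
have [t _ ht] := FIN_top (FINinf_FIN j hA).
exact: leq_ltn_trans (IH _ ht) (blocks_lt hA (ltnSn j) ht hm).
Qed.

Lemma iter_tetris e p m : iter e tetris p m = p m - e.
Proof. by elim: e => [|e IH] /=; rewrite ?subn0 // /tetris IH; lia. Qed.

Lemma rep_top A e q j : FINinf k A -> rep A e q ->
  exists t, [/\ A j t = k, A j t != 0 & q t = k - e j].
Proof.
move=> hA [_ h _]; have [t tk t0] := FIN_top (FINinf_FIN j hA).
by exists t; split => //; rewrite (h j) // tk.
Qed.

(** Distinct blocks have disjoint supports, so at each point the sum has at most one nonzero term;
    indices left out of the list get exponent k. Conversely, the list consists of the j with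
    [e j < k]: there are finitely many, because each makes [q] nonzero where [A j] equals k. *)
Lemma combP A I q : FINinf k A -> comb k I A q <-> spanJ A I q.
Proof.
move=> hA; split.
  case=> hq [s [e [ss sI ek [j0 j0s ej0] qE]]].
  have us : uniq s := sorted_uniq ltn_trans ltnn ss.
  exists (fun j => if j \in s then e j else k); last first.
    by move=> j; case: ifP => [js _|_]; [exact: sI|rewrite ltnn].
  split => // [j m Ajm|m].
    have Z l : l != j -> iter (e l) tetris (A l) m = 0.
      move=> lj; rewrite iter_tetris; case: (eqVneq (A l m) 0) => [->//|Alm].
      by move: lj; rewrite (blocks_inj hA Alm Ajm) eqxx.
    rewrite qE; case: ifP => js.
      rewrite (bigD1_seq j) //= big1 ?addn0 ?iter_tetris // => l; exact: Z.
    rewrite big_seq big1 => [|l ls].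
      by case: (FINinf_FIN j hA) => /(_ m); lia.
    by apply: Z; apply: contraFneq js => <-.
  rewrite qE => h; apply: contrapT => hn; move: h.
  rewrite big1 ?eqxx // => l _; rewrite iter_tetris.
  case: (eqVneq (A l m) 0) => [->//|Alm]; exfalso; apply: hn; by exists l.
case=> e hr hJ; have [hq h1 h2] := hr; split => //.
have [N hN] := FIN_bound hq.
have eN j : e j < k -> j < N.
  move=> ej; have [t [tk t0 qt]] := rep_top j hA hr.
  by apply: leq_ltn_trans (blocks_geq hA t0) (hN t _); rewrite qt -lt0n subn_gt0.
exists [seq j <- iota 0 N | e j < k], e; split.
- by rewrite sorted_filter ?iota_ltn_sorted //; exact: ltn_trans.
- by move=> j; rewrite mem_filter => /andP[/hJ].
- by move=> j; rewrite mem_filter => /andP[/ltnW].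
- have [t qt q0] := FIN_top hq; have [j Aj] := h2 _ q0.
  have ej : e j = 0.
    by have := h1 _ _ Aj; case: (FINinf_FIN j hA) => /(_ t); lia.
  by exists j => //; rewrite mem_filter mem_iota ej hk /= eN ?ej.
apply/funext => m; case: (pselect (exists j, A j m != 0)) => [[j Ajm]|hn].
  rewrite (h1 _ _ Ajm); set s := seq.filter _ _.
  have us : uniq s by rewrite filter_uniq ?iota_uniq.
  have Z l : l != j -> iter (e l) tetris (A l) m = 0.
    move=> lj; rewrite iter_tetris; case: (eqVneq (A l m) 0) => [->//|Alm].
    by move: lj; rewrite (blocks_inj hA Alm Ajm) eqxx.
  case: (boolP (j \in s)) => js.
    by rewrite (bigD1_seq j) //= big1 ?addn0 ?iter_tetris // => l; exact: Z.
  rewrite big_seq big1 => [|l ls].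
    have : k <= e j.
      rewrite leqNgt; apply: contra js => ej.
      by rewrite mem_filter ej mem_iota /= eN.
    by case: (FINinf_FIN j hA) => /(_ m); lia.
  by apply: Z; apply: contraNneq js => <-.
rewrite big1 => [|l _].
  by apply/eqP; apply: contrapT => /negP /h2.
rewrite iter_tetris; case: (eqVneq (A l m) 0) => [->//|Alm].
by exfalso; apply: hn; exists l.
Qed.

Lemma spanJW A I J q : I `<=` J -> spanJ A I q -> spanJ A J q.
Proof. by move=> IJ [e h1 h2]; exists e => // j /h2 /IJ. Qed.

Lemma spanJ_ispan A J q : FINinf k A -> spanJ A J q -> ispan k A q.
Proof. by move=> hA h; apply/combP => //; apply: spanJW h. Qed.

Lemma ispanP A q : FINinf k A -> ispan k A q -> spanJ A setT q.
Proof. by move=> hA h; apply/combP. Qed.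

Lemma spanJ_self A J j : FINinf k A -> J j -> spanJ A J (A j).
Proof.
move=> hA Jj; exists (fun l => if l == j then 0 else k); last first.
  by move=> l; case: eqP => [->//|_]; rewrite ltnn.
split; [exact: FINinf_FIN| |by move=> m hm; exists j].
move=> l m hl; case: eqP => [->|lj]; first by rewrite subn0.
case: (eqVneq (A j m) 0) => [->|hj].
  by case: (FINinf_FIN l hA) => /(_ m); lia.
by case: lj; exact: blocks_inj hA hl hj.
Qed.

(** Exponents add under composition. A block [A j] occurs in at most one [B i], since two of them
    would both be nonzero where [A j] equals k. *)
Lemma spanJ_trans A B I J q : FINinf k A -> FINinf k B ->
  spanJ B I q -> (forall i, I i -> spanJ A J (B i)) -> spanJ A J q.
Proof.
move=> hA hB [e hr hI] hBA; have [hq h1 h2] := hr.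
have hi i : exists f, I i -> rep A f (B i) /\ forall j, f j < k -> J j.
  case: (pselect (I i)) => [/hBA [f f1 f2]|nI]; first by exists f.
  by exists (fun=> 0).
have [f hf] := choice hi.
have uni i i' j : I i -> I i' -> f i j < k -> f i' j < k -> i = i'.
  move=> Ii Ii' fi fi'; have [ri _] := hf _ Ii; have [ri' _] := hf _ Ii'.
  have [t [tk t0 Bt]] := rep_top j hA ri.
  have [_ r1 _] := ri'; have := r1 _ _ t0; rewrite tk => Bt'.
  by apply: (@blocks_inj B i i' t) => //; lia.
pose E j := if pselect (exists i, [/\ I i, e i < k & f i j < k]) is left h
            then f (projT1 (cid h)) j + e (projT1 (cid h)) else k.
have E1 j i : I i -> e i < k -> f i j < k -> E j = f i j + e i.
  move=> Ii ei fi; rewrite /E; case: pselect => [h|h].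
    case: (cid h) => /= i' [Ii' ei' fi'].
    by rewrite (uni _ _ _ Ii Ii' fi fi').
  by exfalso; apply: h; exists i.
have E2 j : ~ (exists i, [/\ I i, e i < k & f i j < k]) -> E j = k.
  by rewrite /E; case: pselect.
have q0 m : q m != 0 ->
    exists i j, [/\ I i, e i < k, f i j < k, A j m != 0 & q m = B i m - e i].
  move=> qm; have [i Bi] := h2 _ qm; have qB := h1 _ _ Bi.
  have ei : e i < k by case: (FINinf_FIN i hB) => /(_ m); lia.
  have Ii := hI _ ei; have [[_ r1 r2] _] := hf _ Ii.
  have [j Aj] := r2 _ Bi; exists i, j; split => //.
  by have := r1 _ _ Aj; case: (FINinf_FIN j hA) => /(_ m); lia.
exists E.
  split => // [j m Aj|m /q0 [i [j [_ _ _ Aj _]]]]; last by exists j.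
  case: (pselect (exists i, [/\ I i, e i < k & f i j < k])) => [[i [Ii ei fi]]|hn].
    rewrite (E1 _ i) //; have [[_ r1 _] _] := hf _ Ii.
    have := r1 _ _ Aj; case: (eqVneq (B i m) 0) => [B0|Bi]; last first.
      by rewrite (h1 _ _ Bi); lia.
    case: (eqVneq (q m) 0) => [->|qm]; first by lia.
    have [i' [j' [Ii' ei' fi' Aj' qB]]] := q0 _ qm.
    have jj := blocks_inj hA Aj Aj'; subst j'.
    by have ii := uni _ _ _ Ii Ii' fi fi'; subst i'; lia.
  rewrite E2 //; case: (eqVneq (q m) 0) => [->|qm].
    by case: (FINinf_FIN j hA) => /(_ m); lia.
  have [i' [j' [Ii' ei' fi' Aj' qB]]] := q0 _ qm.
  by have jj := blocks_inj hA Aj Aj'; subst j'; exfalso; apply: hn; exists i'.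
move=> j Ej; apply: contrapT => nJ; move: Ej; rewrite E2 ?ltnn // => -[i [Ii ei fi]].
by apply: nJ; have [_] := hf _ Ii; exact.
Qed.

Lemma spanJ_lt A I J p q : FINinf k A -> (forall i j, I i -> J j -> i < j) ->
  spanJ A I p -> spanJ A J q -> elt_lt p q.
Proof.
move=> hA IJ [e [_ e1 e2] eI] [f [_ f1 f2] fJ] m n pm qn.
have [i Ai] := e2 _ pm; have [j Aj] := f2 _ qn.
have := e1 _ _ Ai; have := f1 _ _ Aj => qj pi.
apply: (@blocks_lt A i j hA) Ai Aj; apply: IJ.
  by apply: eI; move: pm; rewrite /supp /=; case: (FINinf_FIN i hA) => /(_ m); lia.
by apply: fJ; move: qn; rewrite /supp /=; case: (FINinf_FIN j hA) => /(_ n); lia.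
Qed.

(* The points where A i and A j take the value k lie in the supports of p and q. *)
Lemma rep_lt A e f p q i j : FINinf k A -> rep A e p -> rep A f q ->
  elt_lt p q -> e i < k -> f j < k -> i < j.
Proof.
move=> hA rp rq pq ei fj.
have [s [_ s0 ps]] := rep_top i hA rp; have [t [_ t0 qt]] := rep_top j hA rq.
have st : s < t by apply: pq; rewrite /supp /= ?ps ?qt; lia.
case: (ltngtP i j) => // h.
  by have := blocks_lt hA h t0 s0; lia.
subst j; move: st; have [_ r1 _] := rq; have [_ r2 _] := rp.
have qs := r1 _ _ s0; have pt := r2 _ _ t0.
have : A i t = k /\ A i s = k.
  split.
    have := r1 _ _ t0; rewrite qt; case: (FINinf_FIN i hA) => /(_ t); lia.
  have := r2 _ _ s0; rewrite ps; case: (FINinf_FIN i hA) => /(_ s); lia.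
case=> At As; have : t < t; last by rewrite ltnn.
by apply: pq; rewrite /supp /= ?pt ?qt ?At; lia.
Qed.

Lemma rep_uniq A e f q j : FINinf k A -> rep A e q -> rep A f q -> e j < k -> f j = e j.
Proof.
move=> hA re rf; have [t [tk t0 q1]] := rep_top j hA re.
have [_ r1 _] := rf; have := r1 _ _ t0; lia.
Qed.

Lemma ile_refl A : FINinf k A -> ile k A A.
Proof. by move=> hA n; apply: (@spanJ_ispan A setT) => //; exact: spanJ_self. Qed.

Lemma ile_trans A B C : FINinf k A -> FINinf k B -> FINinf k C ->
  ile k A B -> ile k B C -> ile k A C.
Proof.
move=> hA hB hC AB BC n; apply: (@spanJ_ispan C setT) => //.
apply: (@spanJ_trans C B setT setT) => //; first exact: ispanP.
by move=> i _; exact: ispanP.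
Qed.

Lemma ispan_ile A B q : FINinf k A -> FINinf k B ->
  ispan k B q -> ile k B A -> ispan k A q.
Proof.
move=> hA hB hq BA; apply: (@spanJ_ispan A setT) => //.
by apply: (@spanJ_trans A B setT setT) => // [|i _]; exact: ispanP.
Qed.

End Spans.

(** * Splicing block sequences *)

Section Glue.
Variables (k : nat) (hk : 0 < k).
Implicit Types (p q : elt) (A B C D E : iseq) (I J : set nat).

Definition splice (i : nat) D (n : nat) C : iseq :=
  fun l => if l < i then D l else C (n + (l - i)).

Lemma splice_lo i D n C l : l < i -> splice i D n C l = D l.
Proof. by rewrite /splice => ->. Qed.

Lemma splice_hi i D n C l : i <= l -> splice i D n C l = C (n + (l - i)).
Proof. by rewrite /splice ltnNge => ->. Qed.

Lemma splice_FINinf i D n C : blocks k `I_i D -> FINinf k C ->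
  (forall l, l < i -> elt_lt (D l) (C n)) -> FINinf k (splice i D n C).
Proof.
move=> [d1 d2] [c1 c2] h; split => [l _|l _ _].
  by rewrite /splice; case: ifP => li; [exact: d1|exact: c1].
rewrite /splice; case: ifP => li; case: ifP => li'; last 2 first.
- by lia.
- have -> : n + (l.+1 - i) = (n + (l - i)).+1 by lia.
  exact: c2.
- by apply: d2.
- have -> : n + (l.+1 - i) = n by lia.
  exact: h.
Qed.

Lemma FINinf_blocks i D : FINinf k D -> blocks k `I_i D.
Proof. by move=> [h1 h2]; split => l *; [exact: h1|exact: h2]. Qed.

Lemma splice_tail i D n C q : FINinf k C -> FINinf k (splice i D n C) ->
  spanJ k C [set j | n <= j] q <-> spanJ k (splice i D n C) [set j | i <= j] q.
Proof.
move=> hC hG; split => h.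
  apply: (spanJ_trans hk hG hC h) => j /= nj.
  have -> : C j = splice i D n C (i + (j - n)).
    by rewrite splice_hi; [congr C; lia|lia].
  by apply: spanJ_self => //=; lia.
apply: (spanJ_trans hk hC hG h) => j /= ij.
by rewrite splice_hi //; apply: spanJ_self => //=; lia.
Qed.

Lemma ile_splice i D n C A : FINinf k A -> (forall l, l < i -> ispan k A (D l)) ->
  ile k C A -> ile k (splice i D n C) A.
Proof. by move=> hA hD hC l; rewrite /splice; case: ifP => [/hD|]. Qed.

(* [below_at i D j C] says that [j] is the depth in C of the first i blocks of
   D, so that the blocks of D after these only use blocks of C from C j on. *)
Definition below_at (i : nat) D (j : nat) C : Prop :=
  (forall l, l < i -> spanJ k C [set j' | j' < j] (D l)) /\
  (forall l, i <= l -> spanJ k C [set j' | j <= j'] (D l)).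

(** For positive i, [j] is one more than the largest index of a block of C occurring in [D i.-1]. It
    depends only on the first i blocks of D, and [rep_lt] places the other blocks of any such D'
    before or after it. *)
Lemma below_at_ex i D C : FINinf k D -> FINinf k C -> ile k D C ->
  exists j, (forall D', FINinf k D' -> ile k D' C ->
                (forall l, l < i -> D' l = D l) -> below_at i D' j C) /\
            (forall m, (forall l, l < i -> spanJ k C [set j' | j' < m] (D l)) ->
                j <= m).
Proof.
move=> hD hC DC; case: i => [|i].
  exists 0; split => // D' hD' D'C _; split => // l _.
  by apply: spanJW (ispanP hk hC (D'C l)).
have [e re _] := ispanP hk hC (DC i).
have [hq _ _] := re; have [N hN] := FIN_bound hq.
have ex : exists j, e j < k.
  have [t _ qt] := FIN_top hk hq; have [_ r1 r2] := re.
  by have [j Aj] := r2 _ qt; exists j; have := r1 _ _ Aj; case: (FINinf_FIN j hC) => /(_ t); lia.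
have ub j : e j < k -> j <= N.
  move=> ej; have [t [tk t0 qt]] := rep_top hk j hC re.
  apply: leq_trans (blocks_geq hk hC t0) _; apply/ltnW/hN; rewrite qt; lia.
have [jm ejm jmax] := ex_maxnP ex ub.
exists jm.+1; split => [D' hD' D'C DD|m hm].
  have re' : rep k C e (D' i) by rewrite DD.
  split => l li.
    have [->|ne] := eqVneq l i; first by exists e => // j /jmax.
    have {ne}li : l < i by rewrite ltn_neqAle ne.
    have [f rf _] := ispanP hk hC (D'C l); exists f => // j fj /=.
    exact: ltnW (rep_lt hk hC rf re' (blocks_lt hk hD' li) fj ejm).
  have [f rf _] := ispanP hk hC (D'C l); exists f => // j fj /=.
  exact: (rep_lt hk hC re' rf (blocks_lt hk hD' li) ejm fj).
have [f rf fm] := hm i (ltnSn i).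
by apply: fm; rewrite (rep_uniq hk hC re rf ejm).
Qed.

Lemma below_at_lt i D j C : FINinf k C -> below_at i D j C ->
  forall l, l < i -> elt_lt (D l) (C j).
Proof.
move=> hC [h1 _] l li; apply: (spanJ_lt hk hC _ (h1 _ li) (spanJ_self hk (J := [set j' | j <= j']) hC (leqnn j))).
by move=> a b /= aj jb; exact: leq_trans aj jb.
Qed.

Lemma below_at_splice i D j C : FINinf k C -> FINinf k D -> below_at i D j C ->
  FINinf k (splice i D j C).
Proof.
move=> hC hD h; apply: splice_FINinf => //; first exact: FINinf_blocks.
exact: below_at_lt.
Qed.

Lemma below_at_splice_ile i D j C : FINinf k C -> below_at i D j C ->
  ile k (splice i D j C) C.
Proof.
move=> hC [h1 _]; apply: ile_splice => //; last exact: ile_refl.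
by move=> l /h1; exact: spanJ_ispan.
Qed.

Lemma below_at_ile i D D' j C : FINinf k C -> FINinf k (splice i D j C) ->
  below_at i D' j C -> (forall l, l < i -> D' l = D l) ->
  ile k D' (splice i D j C).
Proof.
move=> hC hG [_ h2] h l; apply: (@spanJ_ispan k hk _ setT) => //.
case: (ltnP l i) => li; last first.
  by apply: spanJW (iffLR (splice_tail (D' l) hC hG) (h2 _ li)).
by rewrite h // -(@splice_lo i D j C) //; exact: spanJ_self.
Qed.

Lemma below_atW i D j C C' : FINinf k C -> FINinf k C' ->
  (forall l, l < j -> C' l = C l) ->
  (forall l, j <= l -> spanJ k C [set j' | j <= j'] (C' l)) ->
  below_at i D j C' -> below_at i D j C.
Proof.
move=> hC hC' h1 h2 [b1 b2]; split => l li.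
  apply: (spanJ_trans hk hC hC' (b1 _ li)) => m /= mj.
  by rewrite h1 //; exact: spanJ_self.
by apply: (spanJ_trans hk hC hC' (b2 _ li)) => m /=; exact: h2.
Qed.

End Glue.

(** * Conditions of a coideal *)

Section Extensions.
Variables (k : nat) (hk : 0 < k) (H : set iseq) (hH : coideal k H).
Implicit Types (p q : elt) (A B C D E : iseq) (I J : set nat).

(** For C in H this is membership of C' in H and in the neighbourhood [j, C]: the refinements that a
    fusion allows once j blocks are fixed. *)
Definition ext (j : nat) C' C : Prop :=
  [/\ H C', ile k C' C & forall l, l < j -> C' l = C l].

Lemma coideal_inf C : H C -> FINinf k C.
Proof. exact: (coideal_sub hH). Qed.

Lemma ext_refl j C : H C -> ext j C C.
Proof. by move=> hC; split => //; apply: ile_refl => //; exact: coideal_inf. Qed.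

Lemma ext_trans j C C' C'' : H C -> ext j C'' C' -> ext j C' C -> ext j C'' C.
Proof.
move=> hC [h1 h2 h3] [g1 g2 g3]; split => // [|l lj]; last by rewrite h3 ?g3.
by apply: ile_trans h2 g2 => //; exact: coideal_inf.
Qed.

Lemma extW i j C' C : i <= j -> ext j C' C -> ext i C' C.
Proof. by move=> ij [h1 h2 h3]; split => // l li; apply: h3; exact: leq_trans ij. Qed.

(** A later block of C' using [C m] with m < j would be nonzero where [C m], which is also [C' m],
    takes the value k, against the block order of C'. *)
Lemma agree_tail j C' C : FINinf k C -> FINinf k C' -> ile k C' C ->
  (forall l, l < j -> C' l = C l) ->
  forall l, j <= l -> spanJ k C [set j' | j <= j'] (C' l).
Proof.
move=> hC hC' h2 h3 l jl.
have [e re _] := ispanP hk hC (h2 l); exists e => // m em /=.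
rewrite leqNgt; apply/negP => mj.
have [t [tk t0 qt]] := rep_top hk m hC re.
have ml : m < l by exact: leq_trans jl.
have := @blocks_lt k hk C' m l hC' ml t t; rewrite /supp /= h3 // t0 qt ltnn.
by move/(_ isT); rewrite -lt0n subn_gt0 em => /(_ isT).
Qed.

Lemma ext_tail j C' C : H C -> ext j C' C ->
  forall l, j <= l -> spanJ k C [set j' | j <= j'] (C' l).
Proof. by move=> /coideal_inf hC [/coideal_inf h1 h2 h3]; exact: agree_tail. Qed.

Lemma below_at_ext i D j C C' : H C -> ext j C' C -> below_at k i D j C' ->
  below_at k i D j C.
Proof.
move=> hC e b; have [/coideal_inf hC' _ h] := e.
exact: (below_atW hk (coideal_inf hC) hC' h (ext_tail hC e) b).
Qed.

Lemma coideal_splice i D n C : H C -> FINinf k (splice i D n C) -> H (splice i D n C).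
Proof.
move=> hC hG; apply: (coideal_fin hH hC hG).
apply: (@sub_finite_set _ _ (D @` `I_i `|` C @` `I_(n + i))); last first.
  by rewrite finite_setU; split; exact/finite_image/finite_II.
move=> x [[[l _ <-] nG]|[[l _ <-] nC]].
  case: (ltnP l (n + i)) => ln; first by right; exists l.
  exfalso; apply: nG; exists (i + (l - n)) => //.
  rewrite splice_hi; last by lia.
  by congr C; lia.
rewrite /splice in nC *; case: ifP nC => [li _|li nC]; first by left; exists l.
by exfalso; apply: nC; exists (n + (l - i)).
Qed.

Lemma coideal_below_splice i D j C : H C -> FINinf k D -> below_at k i D j C ->
  H (splice i D j C).
Proof. by move=> hC hD h; apply: coideal_splice => //; apply: below_at_splice => //; exact: coideal_inf. Qed.

(** The tail of C from j on and the tail of the splice from i on span the same elements. So a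
    refinement found behind the stem of D moves behind the first j blocks of C and back; work done
    for one stem thus becomes a refinement of C. *)
Lemma splice_switch i D j C E : H C -> H (splice i D j C) -> ext i E (splice i D j C) ->
  ext j (splice j C i E) C /\ splice i D j (splice j C i E) = E.
Proof.
move=> hC hG eE; have [hE h2 h3] := eE.
have tl l : i <= l -> spanJ k C [set j' | j <= j'] (E l).
  move=> li; apply: (iffRL (splice_tail hk (E l) (coideal_inf hC) (coideal_inf hG))).
  exact: (ext_tail hG eE).
have fG : FINinf k (splice j C i E).
  apply: (splice_FINinf hk); [by apply: FINinf_blocks; exact: coideal_inf|exact: coideal_inf|] => l lj.
  apply: (spanJ_lt hk (coideal_inf hC) _ (spanJ_self hk (coideal_inf hC) (lj : `I_j l)) (tl i (leqnn i))).
  by move=> a b /= aj jb; exact: leq_trans aj jb.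
split.
  split => [||l lj]; [exact: coideal_splice| |exact: splice_lo].
  move=> l; rewrite /splice; case: ifP => lj; first exact: (ile_refl hk (coideal_inf hC)).
  by apply: (spanJ_ispan hk (coideal_inf hC)); apply: tl; lia.
apply/funext => l; rewrite /splice; case: ifP => li; first by rewrite h3 // splice_lo.
by rewrite ifF; [congr E; lia|lia].
Qed.

Lemma below_at_ext_splice i D D' j C : H C -> H (splice i D j C) -> H D' ->
  below_at k i D' j C -> (forall l, l < i -> D' l = D l) ->
  ext i D' (splice i D j C).
Proof.
move=> hC hG hD' b h; split => // [|l li]; last by rewrite splice_lo // h.
by apply: below_at_ile => //; exact: coideal_inf.
Qed.

Lemma restrP n A B : restr n A = restr n B <-> forall l, l < n -> A l = B l.
Proof.
split => [h l ln|h]; first by rewrite -(nth_mkseq (fun=> 0) A ln) -/(restr n A) h nth_mkseq.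
by apply/eq_in_map => l; rewrite mem_iota => /andP[_ /h].
Qed.

Lemma size_restr n A : size (restr n A) = n.
Proof. exact: size_mkseq. Qed.

Lemma fnth_restr n A l : l < n -> fnth (restr n A) l = A l.
Proof. by move=> ln; rewrite /fnth nth_mkseq. Qed.

Lemma FINfin_restr n A : FINinf k A -> FINfin k (restr n A).
Proof.
move=> [h1 h2]; rewrite /FINfin /= size_restr; split => l ln.
  by rewrite fnth_restr //; exact: h1.
by move=> ln'; rewrite !fnth_restr //; exact: h2.
Qed.

Lemma basicE a A B : basic k a A B <->
  [/\ FINinf k B, restr (size a) B = a & ile k B A].
Proof.
split => [[h1 [n h2] h3]|[h1 h2 h3]]; last by split => //; exists (size a).
by split => //; rewrite -h2 size_restr.
Qed.

Lemma FINbelow_restr n A B : FINinf k B -> ile k B A -> FINbelow k A (restr n B).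
Proof.
move=> hB BA; split; first exact: FINfin_restr.
by exists B; apply/basicE; rewrite size_restr.
Qed.

Lemma fspanP n A q : FINinf k A ->
  fspan k (restr n A) q <-> spanJ k A [set j | j < n] q.
Proof.
move=> hA; rewrite -combP // /fspan size_restr /comb /=.
split => -[hq [s [e [h1 h2 h3 h4 h5]]]]; split => //; exists s, e; split => //.
  rewrite h5; apply/funext => m; rewrite !big_seq; apply: eq_bigr => j /h2 jn.
  by rewrite !(iter_tetris hk) fnth_restr.
rewrite h5; apply/funext => m; rewrite !big_seq; apply: eq_bigr => j /h2 jn.
by rewrite !(iter_tetris hk) fnth_restr.
Qed.

(** The j of [below_at_ex] satisfies the minimality in the definition of [depth], so [xget] returns
    it rather than its default. *)
Lemma below_at_depth i D D' A : FINinf k A -> FINinf k D -> ile k D A ->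
  FINinf k D' -> ile k D' A -> restr i D' = restr i D ->
  below_at k i D' (depth k A (restr i D)) A.
Proof.
move=> hA hD DA hD' D'A DD; have [j [h1 h2]] := below_at_ex hk i hD hA DA.
suff -> : depth k A (restr i D) = j by apply: h1 => //; apply/restrP.
have fleE m : fle k (restr i D) (restr m A) <->
    forall l, l < i -> spanJ k A [set j' | j' < m] (D l).
  rewrite /fle size_restr; split => h l li.
    by apply/fspanP => //; have := h l li; rewrite fnth_restr.
  by rewrite fnth_restr //; apply/fspanP => //; exact: h.
have jP : fle k (restr i D) (restr j A) /\
    forall m, fle k (restr i D) (restr m A) -> j <= m.
  by split => [|m /fleE/h2//]; apply/fleE; have [] := h1 D hD DA (fun _ _ => erefl).
have [d1 d2] := @xgetPex _ 0 [set n | fle k (restr i D) (restr n A) /\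
  forall m, fle k (restr i D) (restr m A) -> n <= m] (ex_intro _ j jP).
by apply/eqP; rewrite eqn_leq d2 ?(jP.2) //; case: jP.
Qed.

Lemma one_block_pigeonhole j C (O : set fseq) : H C ->
  exists2 C', ext j C' C &
    (forall E, ext j E C' -> O (restr j.+1 E)) \/
    (forall E, ext j E C' -> ~ O (restr j.+1 E)).
Proof.
move=> hC; have cC : FINbelow k C (restr j C).
  by apply: FINbelow_restr; [exact: coideal_inf|exact/ile_refl/coideal_inf].
pose O' := [set b | FINlen k j.+1 b /\ O b].
have O'l : O' `<=` FINlen k (size (restr j C)).+1 by rewrite size_restr => b [].
have [B [hB HB] PB] := coideal_pigeonhole hH hC cC O'l.
(* This Y shows where the stem of C ends inside B; the tail of B from there on is attached to that
   stem. *)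
have [Y /basicE [hY aY YB]] := coideal_nonempty hH hC cC (conj hB HB).
rewrite size_restr in aY PB; have /restrP YC := aY.
have [n [hn _]] := below_at_ex hk j hY (coideal_inf HB) YB.
have bY := hn Y hY YB (fun _ _ => erefl).
have hG := coideal_below_splice HB hY bY.
have GB := below_at_splice_ile hk (coideal_inf HB) bY.
have BC : ile k B C by case: hB.
exists (splice j Y n B).
  split => // [|l lj]; last by rewrite splice_lo // YC.
  by apply: ile_trans GB BC => //; exact: coideal_inf.
have EB E : ext j E (splice j Y n B) ->
    (restr j.+1 @` basic k (restr j C) B) (restr j.+1 E) /\ FINlen k j.+1 (restr j.+1 E).
  move=> [hE EG EY]; split; last by split; [exact/FINfin_restr/coideal_inf|exact: size_restr].
  exists E => //; apply/basicE; rewrite size_restr; split; first exact: coideal_inf.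
    by apply/restrP => l lj; rewrite EY // splice_lo // YC.
  by apply: ile_trans EG GB => //; exact: coideal_inf.
case: PB => [PB|PB]; [left|right] => E /EB [e1 e2]; first by case: (PB _ e1).
by move=> OE; suff : set0 (restr j.+1 E) by []; rewrite -PB.
Qed.

End Extensions.

(** * Perfect subsets of the Cantor space *)

Section Cantor.
Implicit Types (x y z : cantor_space) (P Q S : set cantor_space) (m n : nat).

Definition agree n x y : Prop := forall i, i < n -> x i = y i.

Definition cyl x n : set cantor_space := [set y | agree n x y].

Lemma agreeC n x y : agree n x y -> agree n y x.
Proof. by move=> h i /h. Qed.

Lemma agree_trans n x y z : agree n x y -> agree n y z -> agree n x z.
Proof. by move=> h h' i ni; rewrite h ?h'. Qed.

Lemma agreeW m n x y : m <= n -> agree n x y -> agree m x y.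
Proof. by move=> mn h i im; apply: h; exact: leq_trans mn. Qed.

Lemma agree_eq x y : (forall n, agree n x y) -> x = y.
Proof. by move=> h; apply/funext => i; apply: (h i.+1). Qed.

Lemma cyl_eq n x y : agree n x y -> cyl x n = cyl y n.
Proof.
move=> h; apply/seteqP; split => z /= hz; last exact: agree_trans hz.
by apply: agree_trans hz; exact: agreeC.
Qed.

Lemma nbhs_cyl x n : nbhs x (cyl x n).
Proof.
elim: n => [|n IH]; first by apply: filterS filterT => y _ i.
have /= h : nbhs x ((fun y => y n) @^-1` [set x n]).
  exact: (@proj_continuous _ (fun=> bool) n x [set x n] (discrete_set1 _)).
apply: filterS (filterI IH h) => y [/= h1 h2] i; rewrite ltnS leq_eqVlt.
by case/orP => [/eqP ->|/h1].
Qed.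

(** The filter generated by the cylinders at x converges to x in every coordinate, hence in the
    product topology. *)
Lemma nbhs_cylP x (U : set cantor_space) : nbhs x U -> exists n, cyl x n `<=` U.
Proof.
pose F : set_system cantor_space := filter_from setT (cyl x).
have FF : Filter F.
  apply: filter_from_filter; first by exists 0.
  move=> i j _ _; exists (maxn i j) => // y h; split.
    by apply: agreeW h; exact: leq_maxl.
  by apply: agreeW h; exact: leq_maxr.
suff : F --> x by move=> h /h [n _ hn]; exists n.
apply/cvg_sup => i; apply/cvg_image.
  by apply/seteqP; split => // b _; exists (fun=> b).
move=> B hB; exists ((fun y : cantor_space => y i) @^-1` B).
  by exists i.+1 => // y h; rewrite /= -(h i) //; exact: nbhs_singleton.
by apply: image_preimage; apply/seteqP; split => // b _; exists (fun=> b).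
Qed.

Definition seqclosed P := forall y, (forall n, exists2 x, P x & agree n y x) -> P y.

Lemma closedE P : closed P <-> seqclosed P.
Proof.
split => [cP y h|h y cy].
  apply: cP => B /nbhs_cylP [n hn]; have [x Px yx] := h n.
  by exists x; split => //; exact: hn.
by apply: h => n; have [x [Px yx]] := cy _ (nbhs_cyl y n); exists x.
Qed.

Lemma perfectE P : perfect P <-> [/\ P !=set0, seqclosed P &
  forall x n, P x -> exists y, [/\ P y, agree n x y & y <> x]].
Proof.
split => [[[/closedE cP lP] P0]|[P0 cP lP]].
  split => // x n; rewrite -{1}lP => /(_ _ (nbhs_cyl x n)) [y [/eqP ? ? ?]].
  by exists y.
split => //; split; first exact/closedE.
apply/seteqP; split => x.
  move=> lx; apply: cP => n; have [y [_ Py xy]] := lx _ (nbhs_cyl x n).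
  by exists y.
move=> Px U /nbhs_cylP [n hn]; have [y [Py xy /eqP yx]] := lP x n Px.
by exists y; split => //; exact: hn.
Qed.

Lemma seqclosed_cyl P x n : seqclosed P -> seqclosed (P `&` cyl x n).
Proof.
move=> cP y h; split; first by apply: cP => m; have [z []] := h m; exists z.
have [z [_ xz] yz] := h n; apply: agree_trans xz _; exact: agreeC.
Qed.

Lemma perfect_cyl P x n : perfect P -> P x -> perfect (P `&` cyl x n).
Proof.
move=> /perfectE [P0 cP lP] Px; apply/perfectE; split; first by exists x.
  exact: seqclosed_cyl.
move=> y m [Py xy]; have [z [Pz yz zy]] := lP y (maxn m n) Py.
exists z; split => //; last by apply: agreeW yz; exact: leq_maxl.
by split => //; apply: agree_trans xy _; apply: agreeW yz; exact: leq_maxr.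
Qed.

(** A cylinder is clopen, so closedness and accumulation can be checked inside and outside it
    separately. This serves to shrink P in one cylinder and nowhere else. *)
Lemma perfect_replace P Q x n : perfect P -> perfect Q ->
  Q `<=` P `&` cyl x n -> perfect ((P `\` cyl x n) `|` Q).
Proof.
move=> /perfectE [_ cP lP] /perfectE [[q Qq] cQ lQ] QP; apply/perfectE; split.
- by exists q; right.
- move=> y h; case: (pselect (cyl x n y)) => xy; [right|left; split => //].
    apply: cQ => m; have [z Pz yz] := h (maxn m n); exists z.
      case: Pz => // -[_]; case; apply: agree_trans xy _.
      by apply: agreeW yz; exact: leq_maxr.
    by apply: agreeW yz; exact: leq_maxl.
  apply: cP => m; have [z Pz yz] := h m; exists z => //.
  by case: Pz => [[]|/QP[]].
move=> y m [[Py xy]|Qy].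
  have [z [Pz yz zy]] := lP y (maxn m n) Py; exists z; split => //.
    left; split => // xz; apply: xy; apply: agree_trans xz _; apply: agreeC.
    by apply: agreeW yz; exact: leq_maxr.
  by apply: agreeW yz; exact: leq_maxl.
by have [z [Qz yz zy]] := lQ y m Qy; exists z; split => //; right.
Qed.

Lemma cyl_reps m : exists s : seq cantor_space, forall x, exists2 y, y \in s & agree m x y.
Proof.
exists [seq ((fun i => nth false t i) : cantor_space) | t : m.-tuple bool] => x.
exists (fun i => nth false (mkseq x m) i).
  apply/mapP; have sz : size (mkseq x m) == m by rewrite size_mkseq.
  by exists (Tuple sz) => //; rewrite mem_enum.
by move=> i im; rewrite nth_mkseq.
Qed.

Lemma neq_agree x y : x <> y -> exists n, ~ agree n x y.
Proof. by move=> h; apply/existsNP => h'; apply: h; exact: agree_eq. Qed.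

(** There are finitely many cylinders of level m, so the levels at which P splits inside them have a
    common bound. *)
Lemma perfect_split P m : perfect P -> exists2 M, m < M &
  forall x, P x -> exists y z,
    [/\ P y, P z, agree m x y, agree m x z & ~ agree M y z].
Proof.
move=> /perfectE [_ _ lP]; have [s hs] := cyl_reps m.
suff [M hM] : exists M, forall t x, t \in s -> P x -> agree m x t ->
    exists y z, [/\ P y, P z, agree m x y, agree m x z & ~ agree M y z].
  exists (maxn m.+1 M) => [|x Px]; first by rewrite leq_maxl.
  have [t ts xt] := hs x; have [y [z [h1 h2 h3 h4 h5]]] := hM t x ts Px xt.
  by exists y, z; split => // h; apply/h5/agreeW/h; exact: leq_maxr.
elim: s {hs} => [|t s [M hM]]; first by exists 0.
case: (pselect (exists2 x, P x & agree m x t)) => [[x Px xt]|nx]; last first.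
  exists M => t' x; rewrite inE => /predU1P[-> Px xt|]; last exact: hM.
  by exfalso; apply: nx; exists x.
have [y [Py xy yx]] := lP x m Px; have [N hN] := neq_agree yx.
exists (maxn M N) => t' x' ts Px' xt'; have mono y' z' K : K <= maxn M N ->
    ~ agree K y' z' -> ~ agree (maxn M N) y' z'.
  by move=> KM h1 h2; apply/h1/agreeW/h2.
move: ts; rewrite inE => /predU1P[e|ts].
  subst t'; exists y, x; have x'x : agree m x' x by apply: agree_trans xt' (agreeC xt).
  split => //; first exact: agree_trans x'x xy.
  by apply: mono hN; exact: leq_maxr.
have [u [v [h1 h2 h3 h4 h5]]] := hM t' x' ts Px' xt'.
by exists u, v; split => //; apply: mono h5; exact: leq_maxl.
Qed.

(** A point of [P j] is followed through the later sets by points agreeing with it and with one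
    another to growing levels. Their limit lies in the intersection, which is therefore nonempty and
    inherits the splitting. *)
Lemma perfect_fusion (P : nat -> set cantor_space) (M : nat -> nat) :
  P 0 !=set0 -> (forall j, seqclosed (P j)) -> (forall j, P j.+1 `<=` P j) ->
  (forall j, M j < M j.+1) ->
  (forall j x, P j x -> exists y z,
    [/\ P j.+1 y, P j.+1 z, agree (M j) x y, agree (M j) x z &
        ~ agree (M j.+1) y z]) ->
  perfect (\bigcap_j P j).
Proof.
move=> P0 cP sP sM split_.
have sP' i j : i <= j -> P j `<=` P i.
  elim: j => [|j IH]; first by rewrite leqn0 => /eqP ->.
  rewrite leq_eqVlt => /predU1P[->//|/IH h]; apply: subset_trans h; exact: sP.
have sM' i j : i <= j -> M i <= M j.
  elim: j => [|j IH]; first by rewrite leqn0 => /eqP ->.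
  by rewrite leq_eqVlt => /predU1P[->//|/IH h]; apply: leq_trans h _; exact: ltnW.
have Mj j : j <= M j by elim: j => // j IH; apply: leq_ltn_trans (sM j).
have limit j x : P j x -> exists2 y, (\bigcap_i P i) y & agree (M j) x y.
  move=> Px; have next i z : exists z', P (j + i) z -> P (j + i).+1 z' /\ agree (M (j + i)) z z'.
    case: (pselect (P (j + i) z)) => [/split_ [y [_ [h _ h' _ _]]]|h]; first by exists y.
    by exists z.
  have [f hf] := choice (fun p : nat * cantor_space => next p.1 p.2).
  pose g := fix g i := if i is i'.+1 then f (i', g i') else x.
  have gP i : P (j + i) (g i).
    by elim: i => [|i IH]; [rewrite addn0|rewrite addnS; exact: (hf (i, g i) IH).1].
  have gg i l : i <= l -> agree (M (j + i)) (g i) (g l).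
    elim: l => [|l IH]; first by rewrite leqn0 => /eqP ->.
    rewrite leq_eqVlt => /predU1P[->//|il]; apply: agree_trans (IH il) _.
    by apply: agreeW (hf (l, g l) (gP l)).2; apply: sM'; rewrite leq_add2l.
  pose y : cantor_space := fun i => g i.+1 i.
  have gy i : agree (M (j + i)) (g i) y.
    move=> l hl; rewrite /y; case: (leqP i l.+1) => il; first exact: gg.
    apply/esym; apply: (gg l.+1 i (ltnW il)); apply: leq_trans (Mj _); lia.
  exists y; last by have := gy 0; rewrite addn0.
  move=> i _; apply: cP => n; exists (g (n + i)).
    by apply: (sP' i (j + (n + i))); [lia|exact: gP].
  by apply/agreeC/agreeW/gy; apply: leq_trans (Mj _); lia.
apply/perfectE; split.
- by have [x Px] := P0; have [y Py _] := limit 0 x Px; exists y.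
- move=> y h j _; apply: cP => n; have [x Px yx] := h n; exists x => //.
  exact: Px.
move=> x n Px; have [y [z [Py Pz xy xz yz]]] := split_ n x (Px n I).
(* The two points y and z differ below [M n.+1], so at least one of them differs there from x. *)
have [w [Pw xw wx]] : exists w, [/\ P n.+1 w, agree (M n) x w & ~ agree (M n.+1) w x].
  case: (pselect (agree (M n.+1) y x)) => yx; last by exists y.
  by exists z; split => // zx; apply: yz; apply: agree_trans yx (agreeC zx).
have [u Pu wu] := limit _ _ Pw; exists u; split => //.
  apply: agreeW (Mj n) _; apply: agree_trans xw _.
  by apply: agreeW wu; exact: ltnW.
by move=> ux; apply: wx; rewrite -ux.
Qed.

End Cantor.

(** Goodness passes to smaller elements, so tasks are met one after another without spoiling earlier
    ones. *)
Lemma all_tasks (T : eqType) (X : Type) (le : X -> X -> Prop) (good : T -> X -> Prop)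
    (s : seq T) (x : X) :
  (forall x, le x x) -> (forall x y z, le x y -> le y z -> le x z) ->
  (forall t x y, le x y -> good t y -> good t x) ->
  (forall t y, t \in s -> le y x -> exists2 z, le z y & good t z) ->
  exists2 z, le z x & forall t, t \in s -> good t z.
Proof.
move=> le_refl le_tr gle; elim: s => [|t s IH] hs; first by exists x.
have [|y yx gy] := IH; first by move=> u y us; apply: hs; rewrite inE us orbT.
have [z zy gz] := hs t y (mem_head _ _) yx.
exists z => [|u]; first exact: le_tr yx.
by rewrite inE => /predU1P[->//|us]; apply: gle zy _; exact: gy.
Qed.

(** * Strategies against a semiselective coideal *)

Lemma wo_least (W : Type) : exists le : W -> W -> Prop,
  (forall P : W -> Prop, (exists w, P w) ->
     exists w, P w /\ forall v, P v -> le w v) /\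
  (forall v w, le v w -> le w v -> v = w).
Proof.
have [R hR] := well_ordering_principle {classic W}.
exists (fun v w => R v w); split => [P [w Pw]|v w vw wv].
  have [|z [[zP lz] _]] := hR [pred w | `[< P w >]].
    by exists w; apply/asboolP.
  exists z; split; first by move: zP => /asboolP.
  by move=> v Pv; apply: lz; apply/asboolP.
have anti := @wo_chain_antisymmetric {classic W} R predT (withinW hR).
by apply: anti => //; rewrite vw wv.
Qed.

(* A play against a nondeterministic strategy [R] for refining conditions.  In
   state [w], having fixed the first [j] blocks, player II refines the current
   condition to some C and moves to a state w' with [R j w C w'].  Semiselectivity
   produces a single B in H every initial segment of which follows the strategy. *)
Section Strategy.
Variables (k : nat) (hk : 0 < k) (H : set iseq) (hH : coideal k H).
Hypothesis hsemi : semiselective k H.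
Variables (W : Type) (R : nat -> W -> iseq -> W -> Prop).
Variables (Inv : nat -> W -> iseq -> Prop) (A : iseq) (j0 : nat) (w0 : W).
Local Notation ext := (ext k H).
Hypothesis hA : H A.
Hypothesis R_open : forall j w C C' w', H C ->
  R j w C w' -> ext j C' C -> R j w C' w'.
Hypothesis R_dense : forall j w C, j0 <= j -> ext j0 C A -> Inv j w C ->
  exists C' w', ext j C' C /\ R j w C' w'.
Hypothesis R_step : forall j w C w', j0 <= j -> ext j0 C A ->
  R j w C w' -> Inv j.+1 w' C.
Hypothesis Inv0 : forall C, ext j0 C A -> Inv j0 w0 C.
Implicit Types (C D E Y : iseq).

Let fH C : H C -> FINinf k C. Proof. exact: coideal_inf. Qed.

Let extT j C C' C'' : H C -> ext j C'' C' -> ext j C' C -> ext j C'' C.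
Proof. exact: ext_trans. Qed.

Let le := projT1 (cid (wo_least W)).

Let le_least (P : W -> Prop) : (exists w, P w) ->
  exists w, P w /\ forall v, P v -> le w v.
Proof. by have [] := projT2 (cid (wo_least W)) => h _; exact: h. Qed.

Let le_anti v w : le v w -> le w v -> v = w.
Proof. by have [] := projT2 (cid (wo_least W)) => _ h; exact: h. Qed.

(* Taking the least possible move makes the play along compatible conditions
   unique, which is what lets finitely many blocks determine the state. *)
Let G j w E w' := R j w E w' /\ forall v C, ext j C E -> R j w C v -> le w' v.

Let G_open j w E E' w' : H E -> ext j E' E -> G j w E w' -> G j w E' w'.
Proof.
move=> hE e [g1 g2]; split => [|v C eC]; first exact: R_open g1 e.
by apply: g2; apply: extT e.
Qed.

Let G_dense j w C : j0 <= j -> ext j0 C A -> Inv j w C ->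
  exists C' w', ext j C' C /\ G j w C' w'.
Proof.
move=> jj eC I; have [C1 [w1 [e1 r1]]] := R_dense jj eC I.
have [|w' [[C' [e' r']] least]] := le_least (P := fun v => exists C', ext j C' C /\ R j w C' v).
  by exists w1, C1.
exists C', w'; split => //; split => // v C2 e2 r2; apply: least; exists C2; split => //.
by apply: extT e'; case: eC.
Qed.

Let almost E E' := exists m, forall q, ispan k E q ->
  (forall x, q x != 0 -> m <= x) -> ispan k E' q.

(** The condition carrying the move has to contain E only from some point on, so the move does not
    depend on any finite number of blocks of E after the first j. *)
Let Gs j w E w' := exists E',
  [/\ H E', forall l, l < j -> E l = E' l, almost E E' & G j w E' w'].

(** The first j blocks of E followed by a late tail of E refine both witnesses. There both moves are
    legal, so each, being least, is at most the other. *)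
Let Gs_uniq j w E w1 w2 : H E -> Gs j w E w1 -> Gs j w E w2 -> w1 = w2.
Proof.
move=> hE [E1 [hE1 a1 [m1 b1] g1]] [E2 [hE2 a2 [m2 b2] g2]].
have fE := fH hE; pose M := j + (m1 + m2).
have fD : FINinf k (splice j E M E).
  apply: splice_FINinf => //; first exact: FINinf_blocks.
  by move=> l lj; apply: (blocks_lt hk fE); rewrite /M; lia.
have hD : H (splice j E M E) by exact: (coideal_splice hk hH hE fD).
have eD E' m : H E' -> m <= M -> (forall l, l < j -> E l = E' l) ->
    (forall q, ispan k E q -> (forall x, q x != 0 -> m <= x) -> ispan k E' q) ->
    ext j (splice j E M E) E'.
  move=> hE' mM a b; split => // [l|l lj]; last by rewrite splice_lo // a.
  rewrite /splice; case: ifP => lj.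
    by rewrite a //; apply: ile_refl => //; exact: fH.
  apply: b; first exact: ile_refl.
  by move=> x /(blocks_geq hk fE); lia.
have eD1 := eD E1 m1 hE1 _ a1 b1; have eD2 := eD E2 m2 hE2 _ a2 b2.
have {}eD1 : ext j (splice j E M E) E1 by apply: eD1; rewrite /M; lia.
have {}eD2 : ext j (splice j E M E) E2 by apply: eD2; rewrite /M; lia.
have [r1 _] := G_open hE1 eD1 g1; have [r2 _] := G_open hE2 eD2 g2.
by apply: le_anti; [case: g1 => _ h; exact: h eD1 r2|case: g2 => _ h; exact: h eD2 r1].
Qed.

Let Gs_ext j w E E' w' : H E -> ext j E' E -> Gs j w E w' -> Gs j w E' w'.
Proof.
move=> hE [hE' E'E a'] [E1 [hE1 a1 [m b1] g1]]; exists E1; split => //.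
  by move=> l lj; rewrite a' ?a1.
exists m => q hq; apply: b1.
exact: (ispan_ile hk (fH hE) (fH hE') hq E'E).
Qed.

Let G_Gs j w E E' w' : H E -> ext j E' E -> G j w E w' -> Gs j w E' w'.
Proof.
move=> hE [hE' E'E a'] g; exists E; split => //; exists 0 => q hq _.
exact: (ispan_ile hk (fH hE) (fH hE') hq E'E).
Qed.

Fixpoint reach i E w : Prop :=
  if i is i'.+1 then exists v, reach i' E v /\ Gs (j0 + i') v E w else w = w0.

Let reach_uniq i E w w' : H E -> reach i E w -> reach i E w' -> w = w'.
Proof.
move=> hE; elim: i w w' => [|i IH] w w' /=; first by move=> -> ->.
move=> [v [r g]] [v' [r' g']]; move: g; rewrite (IH _ _ r r') => g.
exact: Gs_uniq g g'.
Qed.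

Let reach_ext i E E' w : H E -> ext (j0 + i) E' E -> reach i E w -> reach i E' w.
Proof.
move=> hE; elim: i w => //= i IH w e [v [r g]].
have {}e : ext (j0 + i) E' E by apply: extW e; rewrite leq_add2l.
by exists v; split; [exact: IH|exact: Gs_ext g].
Qed.

Let chain i E := exists w w', reach i E w /\ G (j0 + i) w E w'.

Let chain_ext i E E' : H E -> ext (j0 + i) E' E -> chain i E -> chain i E'.
Proof.
move=> hE e [w [w' [r g]]]; exists w, w'; split; first exact: reach_ext r.
exact: G_open g.
Qed.

(** A without its first [j0] blocks. The sequence given by semiselectivity need not keep a stem, so
    semiselectivity is applied to [A'] and [prepend] puts the stem back. *)
Let A' := splice 0 A j0 A.

Let fA : FINinf k A. Proof. exact: fH hA. Qed.

Let fA' : FINinf k A'.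
Proof. by apply: splice_FINinf => //; exact: FINinf_blocks. Qed.

Let hA' : H A'. Proof. exact: (coideal_splice hk hH hA fA'). Qed.

Let A'_tail q : ispan k A' q -> spanJ k A [set j | j0 <= j] q.
Proof.
move=> /(ispanP hk fA') h; apply/(splice_tail hk q fA fA').
exact: spanJW h.
Qed.

Let A'A : ile k A' A.
Proof. by move=> l; apply: (spanJ_ispan hk fA); apply: A'_tail; exact: ile_refl. Qed.

Let A_lt l q : l < j0 -> ispan k A' q -> elt_lt (A l) q.
Proof.
move=> lj /A'_tail h.
apply: (spanJ_lt hk fA _ (spanJ_self hk fA (lj : `I_j0 l)) h).
by move=> a b /= aj jb; exact: leq_trans aj jb.
Qed.

Let prepend Y := splice j0 A 0 Y.

Let prepend_FINinf Y : FINinf k Y -> ile k Y A' -> FINinf k (prepend Y).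
Proof.
move=> hY YA; apply: splice_FINinf => //; first exact: FINinf_blocks.
by move=> l lj; exact: A_lt.
Qed.

Let prepend_ile Y : FINinf k Y -> ile k Y A' -> ile k (prepend Y) A.
Proof.
move=> hY YA; apply: ile_splice => //; last exact: ile_trans YA A'A.
by move=> l _; exact: ile_refl.
Qed.

Let graft i Y n C := splice (j0 + i) (prepend Y) n C.

Let graft_restr i Y n C : graft i (fnth (restr i Y)) n C = graft i Y n C.
Proof.
apply/funext => l; rewrite /graft /prepend /splice; case: ifP => // li; case: ifP => // lj.
by rewrite fnth_restr //; lia.
Qed.

Section OneSegment.
Variables (i : nat) (Y : iseq).
Hypotheses (fY : FINinf k Y) (YA' : ile k Y A').
Local Notation n := (depth k A' (restr i Y)).

Let n_below Y' : FINinf k Y' -> ile k Y' A' -> restr i Y' = restr i Y ->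
  below_at k i Y' n A'.
Proof. exact: below_at_depth. Qed.

Lemma graft_FINinf C : ext n C A' -> FINinf k (graft i Y n C).
Proof.
move=> [hC CA' a]; have fC := fH hC.
apply: splice_FINinf => //; first by apply: FINinf_blocks; exact: prepend_FINinf.
move=> l li; rewrite /prepend /splice; case: ifP => lj.
  by apply: A_lt => //; exact: CA'.
have [b _] := n_below fY YA' erefl.
have {}b : spanJ k C [set j | j < n] (Y (0 + (l - j0))).
  apply: (spanJ_trans hk fC fA' (b _ _)); first by lia.
  by move=> m mn; rewrite -a //; exact: spanJ_self.
apply: (spanJ_lt hk fC _ b (spanJ_self hk (J := [set j | n <= j]) fC (leqnn n))).
by move=> x y /= xn ny; exact: leq_trans xn ny.
Qed.

Lemma graft_coideal C : ext n C A' -> H (graft i Y n C).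
Proof. by move=> e; apply: (coideal_splice hk hH _ (graft_FINinf e)); case: e. Qed.

Lemma graft_stem C : ext n C A' -> ext j0 (graft i Y n C) A.
Proof.
move=> e; have [hC CA' a] := e; split; first exact: graft_coideal.
  apply: ile_splice => //; first by move=> l _; exact: prepend_ile.
  by apply: ile_trans CA' A'A => //; exact: fH.
by move=> l lj; rewrite /graft /prepend !splice_lo //; lia.
Qed.

Lemma graft_ext C C' : ext n C A' -> ext n C' C -> ext (j0 + i) (graft i Y n C') (graft i Y n C).
Proof.
move=> e e'; have [hC CA' a] := e; have fC := fH hC.
have eA : ext n C' A' by exact: extT e.
have fG := graft_FINinf e; split; first exact: graft_coideal.
  move=> l; case: (ltnP l (j0 + i)) => li.
    rewrite [graft i Y n C' l]splice_lo // -(@splice_lo (j0 + i) (prepend Y) n C) //; exact: ile_refl.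
  rewrite [graft i Y n C' l]splice_hi //; apply: (spanJ_ispan hk fG (J := [set j | j0 + i <= j])).
  by apply/(splice_tail hk _ fC fG); apply: (ext_tail hk hH hC e') => //; lia.
by move=> l li; rewrite /graft !splice_lo.
Qed.

Lemma graft_switch C E : ext n C A' -> ext (j0 + i) E (graft i Y n C) ->
  ext n (splice n C (j0 + i) E) C /\ graft i Y n (splice n C (j0 + i) E) = E.
Proof. by move=> e; have [hC _ _] := e; exact: (splice_switch hk hH hC (graft_coideal e)). Qed.

Lemma graft_play C : ext n C A' -> ile k Y C -> H Y ->
  ext (j0 + i) (prepend Y) (graft i Y n C).
Proof.
move=> e YC hY; have [hC CA' a] := e; have fC := fH hC; have fG := graft_FINinf e.
have fP := prepend_FINinf fY YA'; split.
- exact: (coideal_splice hk hH hY fP).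
- move=> l; case: (ltnP l (j0 + i)) => li.
    rewrite -{1}(@splice_lo (j0 + i) (prepend Y) n C) //; exact: ile_refl.
  apply: (spanJ_ispan hk fG (J := [set j | j0 + i <= j])).
  apply/(splice_tail hk _ fC fG); rewrite /prepend splice_hi; last by lia.
  have [_ b] := n_below fY YA' erefl.
  have {}b := b (0 + (l - j0)).
  have [e1 r1 h1] : spanJ k A' [set j | n <= j] (Y (0 + (l - j0))) by apply: b; lia.
  have [e2 r2 _] := ispanP hk fC (YC (0 + (l - j0))).
  (* A block [C j] with j < n equals [A' j], so its occurrence would show up in the representation
     over [A'], which starts at n. *)
  exists e2 => // j ej /=; rewrite leqNgt; apply/negP => jn.
  have [t [tk t0 qt]] := rep_top hk j fC r2.
  have [_ r3 _] := r1; have := r3 j t; rewrite -a // t0 tk qt => /(_ isT) X.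
  have ej1 : e1 j < k by lia.
  by have := h1 _ ej1; rewrite /= leqNgt jn.
by move=> l li; rewrite /graft splice_lo.
Qed.

End OneSegment.

(** Either the play behind the stem c has its next move, or no refinement provides one. The states
    are quantified inside [chain], so this dense open family can be fixed before any play takes
    place. *)
Let Dfam (c : fseq) : set iseq := [set C | ext (depth k A' c) C A' /\
  (chain (size c) (graft (size c) (fnth c) (depth k A' c) C) \/
   forall C', ext (depth k A' c) C' A' -> ile k C' C ->
     ~ chain (size c) (graft (size c) (fnth c) (depth k A' c) C'))].

Let ext_of_ile n C C' : ext n C A' -> ext n C' A' -> ile k C' C -> ext n C' C.
Proof. by move=> [_ _ a] [h _ a'] l; split => // x xn; rewrite a' ?a. Qed.

Let basicnE n C : (H `&` basicn k n A') C <-> ext n C A'.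
Proof.
split => [[h /basicE [_ a b]]|[h b a]].
  by move: a; rewrite size_restr => /restrP a.
split => //; apply/basicE; rewrite size_restr; split => //; first exact: fH h.
exact/restrP.
Qed.

Let Dfam_dense c : FINbelow k A' c ->
  dense_open k (Dfam c) (H `&` basicn k (depth k A' c) A').
Proof.
move=> [_ [Y /basicE [fY cY YA]]].
have [i ci] : exists i, c = restr i Y by exists (size c).
clear cY; subst c.
split; first by move=> C [/basicnE].
  move=> C /basicnE eC.
  case: (pselect (exists C', [/\ ext (depth k A' (restr i Y)) C' A', ile k C' C &
     chain (size (restr i Y)) (graft (size (restr i Y)) (fnth (restr i Y)) (depth k A' (restr i Y)) C')])) => [[C' [e' i' c']]|nC].
    by exists C' => //; split => //; left.
  exists C; last by apply: ile_refl => //; apply: fH; case: eC.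
  by split => //; right => C' e' i' c'; apply: nC; exists C'.
move=> C C' /basicnE eC [eC' DC'] CC'; split => //.
have eCC' := ext_of_ile eC' eC CC'.
case: DC' => [ch|nch]; [left|right].
  rewrite size_restr !graft_restr in ch *.
  apply: chain_ext ch; first exact: (graft_coideal fY YA).
  exact: (graft_ext fY YA).
move=> C'' e'' i''; apply: nch => //.
by apply: ile_trans i'' CC' => //; apply: fH; [case: e''|case: eC|case: eC'].
Qed.

Theorem semiselective_strategy : exists B (w : nat -> W),
  [/\ ext j0 B A, w j0 = w0 & forall j, j0 <= j -> R j (w j) B (w j.+1)].
Proof.
have [|B0 [F [[hB0 B0A'] FD FB]]] := hsemi hA' Dfam_dense (C := A').
  by split => //; exact: ile_refl.
have fB0 := fH hB0; pose B := prepend B0.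
have below i : FINbelow k A' (restr i B0) by exact: FINbelow_restr.
have below0 i : FINbelow k B0 (restr i B0).
  by apply: FINbelow_restr => //; exact: ile_refl.
pose n i := depth k A' (restr i B0); pose Fi i := F (restr i B0).
pose E i := graft i B0 (n i) (Fi i).
have eF i : ext (n i) (Fi i) A' by have [] := FD _ (below i).
have B0F i : ile k B0 (Fi i).
  have : basic k (restr i B0) B0 B0.
    by apply/basicE; rewrite size_restr; split => //; exact: ile_refl.
  by move/(FB _ (below0 i)) => /basicE[].
have eB i : ext (j0 + i) B (E i) by have := graft_play fB0 B0A' (eF i) (B0F i) hB0; exact.
have hE i : H (E i) by have := graft_coideal fB0 B0A' (eF i); exact.
have hB : H B by case: (eB 0).
have eBA : ext j0 B A.
  apply: extT (graft_stem fB0 B0A' (eF 0)) => //.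
  by apply: extW (eB 0); rewrite addn0.
(* By density some refinement of B has a move in the state reached. Carried back by [graft_switch],
   it refines [Fi i], which excludes the negative alternative of [Dfam]. *)
have chE i w : reach i B w -> Inv (j0 + i) w B -> chain i (E i).
  move=> rw Iw; have [C' [w' [eC' g]]] := G_dense (leq_addr _ _) eBA Iw.
  have [_ [ch|nch]] := FD _ (below i).
    by rewrite size_restr graft_restr in ch.
  have eC'E : ext (j0 + i) C' (E i) by exact: extT (eB i).
  have [s1 s2] := graft_switch fB0 B0A' (eF i) eC'E.
  exfalso; apply: (nch (splice (n i) (Fi i) (j0 + i) C')).
  - exact: extT (eF i).
  - by case: s1.
  rewrite size_restr graft_restr s2; exists w, w'; split => //.
  exact: reach_ext rw.
have step i w : reach i B w -> Inv (j0 + i) w B ->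
    exists w', [/\ reach i.+1 B w', R (j0 + i) w B w' & Inv (j0 + i.+1) w' B].
  move=> rw Iw; have [v [w' [rv g]]] := chE i w rw Iw.
  (* B refines [E i], so the state reached along [E i] is also reached along B, where it is
     unique. *)
  have vw := reach_uniq hB (reach_ext (hE i) (eB i) rv) rw; subst v.
  have r : R (j0 + i) w B w' by have [] := G_open (hE i) (eB i) g.
  exists w'; split => //=; first by exists w; split => //; exact: G_Gs g.
  by rewrite addnS; apply: R_step r => //; exact: leq_addr.
have all i : exists w, reach i B w /\ Inv (j0 + i) w B.
  elim: i => [|i [w [rw Iw]]]; first by exists w0; rewrite addn0; split => //; exact: Inv0.
  by have [w' [r' _ I']] := step i w rw Iw; exists w'.
have [w hw] := choice all.
exists B, (fun j => w (j - j0)); split => //.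
  by rewrite subnn; have [-> _] := hw 0.
move=> j jj; have [rw Iw] := hw (j - j0); have [w' [r' Rw _]] := step _ _ rw Iw.
have [rw' _] := hw (j - j0).+1.
move: Rw; rewrite (reach_uniq hB r' rw') subnKC //.
by rewrite -subSn.
Qed.

End Strategy.

(** * Deciding a property by fusion *)

Section FiniteDepth.
Variables (k : nat) (hk : 0 < k).

(** The first j blocks of C vanish from some M on. So i is at most M, and the first i blocks of D
    are determined by functions from M points to k+1 values. *)
Lemma finite_below (j : nat) (C : iseq) : FINinf k C ->
  exists s : seq fseq, forall i D, FINinf k D -> below_at k i D j C -> restr i D \in s.
Proof.
move=> hC; have [M hM] : exists M, forall l m, l < j -> C l m != 0 -> m < M.
  elim: j => [|j [M hM]]; first by exists 0.
  have [N hN] := FIN_bound (FINinf_FIN j hC).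
  exists (maxn M N) => l m; rewrite ltnS leq_eqVlt => /predU1P[->|lj] h.
    by rewrite leq_max hN ?orbT.
  by rewrite leq_max (hM l).
pose T := {ffun 'I_M -> 'I_k.+1}.
pose dec (t : T) : elt := fun m => if insub m is Some o then val (t o) else 0.
exists (flatten [seq [seq map dec t | t : i.-tuple T] | i <- iota 0 M.+1]).
move=> i D hD [b _].
have bM l m : l < i -> D l m != 0 -> m < M.
  move=> li Dm; have [e [_ e1 e2] eJ] := b _ li.
  have [j' Cj'] := e2 _ Dm; apply: (hM j') => //; apply: eJ.
  by have := e1 _ _ Cj'; case: (FINinf_FIN j' hC) => /(_ m); lia.
have iM : i <= M.
  case: i b bM => // i b bM; have [t _ ht] := FIN_top hk (FINinf_FIN i hD).
  exact: leq_ltn_trans (blocks_geq hk hD ht) (bM _ _ (ltnSn i) ht).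
apply/flatten_mapP; exists i; first by rewrite mem_iota.
pose t := mkseq (fun l => [ffun o : 'I_M => inord (D l o)] : T) i.
have sz : size t == i by rewrite size_mkseq.
apply/mapP; exists (Tuple sz); first by rewrite mem_enum.
rewrite /= /t /restr /mkseq -map_comp; apply/eq_in_map => l.
rewrite mem_iota /= add0n => li; apply/funext => m; rewrite /dec.
case: insubP => [o _ om|]; last first.
  by rewrite -leqNgt leqNgt => h; apply/eqP; apply: contraNT h; exact: bM.
by rewrite ffunE om /= inordK // ltnS; case: (FINinf_FIN l hD) => /(_ m).
Qed.

End FiniteDepth.

Section Decision.
Variables (k : nat) (hk : 0 < k) (H : set iseq) (hH : coideal k H).
Hypothesis hsemi : semiselective k H.
Local Notation ext := (ext k H).
Variable Phi : set cantor_space -> nat -> iseq -> Prop.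
Hypothesis Phi_mono : forall P P' i D D', H D -> Phi P i D -> P' `<=` P ->
  ext i D' D -> Phi P' i D'.

Definition refutes P i D : Prop := forall P' D',
  perfect P' -> P' `<=` P -> ext i D' D -> ~ Phi P' i D'.

Lemma refutes_mono P P' i D D' : H D -> refutes P i D -> P' `<=` P ->
  ext i D' D -> refutes P' i D'.
Proof.
move=> hD n PP e Q E pQ QP' eE; apply: n => //; first exact: subset_trans PP.
exact: (ext_trans hk hH hD eE).
Qed.

Let decided P b j C :=
  (forall D, H D -> below_at k (size b) D j C -> restr (size b) D = b ->
     Phi P (size b) D) \/
  (forall D, H D -> below_at k (size b) D j C -> restr (size b) D = b ->
     refutes P (size b) D).

Let decided_mono P P' b j C C' : H C -> decided P b j C -> P' `<=` P ->
  ext j C' C -> decided P' b j C'.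
Proof.
move=> hC d PP e; case: d => d; [left|right] => D hD bD rD.
  apply: (Phi_mono hD (d D hD _ rD) PP (ext_refl hk hH _ hD)).
  exact: (below_at_ext hk hH hC e).
apply: (refutes_mono hD (d D hD _ rD) PP (ext_refl hk hH _ hD)).
exact: (below_at_ext hk hH hC e).
Qed.

(** If the condition with stem b does not refute [Phi] on the cylinder, a smaller pair satisfies it.
    Its perfect set replaces P inside that cylinder, its sequence is carried back behind the first j
    blocks of C, and every cylinder of level m that met P is still met. *)
Let decide_one P m y b j C : perfect P -> H C ->
  exists P' C', [/\ perfect P', P' `<=` P, ext j C' C,
    forall x, P x -> exists2 x', P' x' & agree m x x' &
    (exists2 x, P' x & agree m y x) -> decided (P' `&` cyl y m) b j C'].
Proof.
move=> pP hC; have triv : decided (P `&` cyl y m) b j C \/ ~ (exists2 x, P x & agree m y x) ->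
    exists P' C', [/\ perfect P', P' `<=` P, ext j C' C,
      forall x, P x -> exists2 x', P' x' & agree m x x' &
      (exists2 x, P' x & agree m y x) -> decided (P' `&` cyl y m) b j C'].
  move=> h; exists P, C; split => //; first exact: ext_refl.
    by move=> x Px; exists x.
  by case: h.
case: (pselect (exists2 x, P x & agree m y x)) => [[x Px yx]|nx]; last by apply: triv; right.
case: (pselect (exists D, [/\ H D, below_at k (size b) D j C & restr (size b) D = b]))
    => [[D [hD bD rD]]|nD]; last first.
  by apply: triv; left; left => D hD bD rD; exfalso; apply: nD; exists D.
have hE := coideal_below_splice hk hH hC (coideal_inf hH hD) bD; set E := splice _ _ _ _ in hE.
have agr D' : restr (size b) D' = b -> forall l, l < size b -> D' l = D l.
  by rewrite -[RHS]rD => /restrP.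
case: (pselect (refutes (P `&` cyl y m) (size b) E)) => [nE|/existsNP [P0 /existsNP [E'
    /not_implyP [pP0 /not_implyP [P0P /not_implyP [eE' /contrapT ph]]]]]].
  apply: triv; left; right => D' hD' bD' rD'; apply: (refutes_mono hE nE) => //.
  exact: (below_at_ext_splice hk hH hC hE hD' bD' (agr _ rD')).
have [eC' sE'] := splice_switch hk hH hC hE eE'.
exists ((P `\` cyl y m) `|` P0), (splice j C (size b) E').
have cE := cyl_eq yx; have hE' : H E' by case: eE'.
split => //.
- by rewrite cE; apply: perfect_replace => //; rewrite -cE.
- by move=> z [[]|/P0P[]].
- move=> z Pz; case: (pselect (cyl y m z)) => yz; last by exists z => //; left.
  case: pP0 => _ [z' P0z']; exists z'; first by right.
  by have [_ yz'] := P0P _ P0z'; apply: agree_trans yz'; exact: agreeC.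
move=> _; left => D' hD' bD' rD'; have hC' : H (splice j C (size b) E') by case: eC'.
apply: (Phi_mono hE' ph); first by move=> z [[[_ nz]|//]].
rewrite -[X in ext _ _ X]sE'; apply: (below_at_ext_splice hk hH hC' _ hD' bD' (agr _ rD')).
by rewrite sE'.
Qed.

(** There are finitely many stems of depth j and finitely many cylinders of level m; [decide_one] is
    run through all pairs. *)
Let decide_all P m j C : perfect P -> H C ->
  exists P' C', [/\ perfect P', P' `<=` P, ext j C' C,
    forall x, P x -> exists2 x', P' x' & agree m x x' &
    forall b x, P' x -> decided (P' `&` cyl x m) b j C'].
Proof.
move=> pP hC; have [s hs] := finite_below hk j (coideal_inf hH hC); have [r hr] := cyl_reps m.
(* The implications make this a preorder on all pairs, not only on those with a perfect set and a
   member of H. *)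
pose le (a c : set cantor_space * iseq) := (perfect c.1 -> perfect a.1) /\
  [/\ a.1 `<=` c.1, (forall x, c.1 x -> exists2 x', a.1 x' & agree m x x') &
      (H c.2 -> ext j a.2 c.2)].
pose good (t : fseq * cantor_space) (a : set cantor_space * iseq) := H a.2 /\
  ((exists2 x, a.1 x & agree m t.2 x) -> decided (a.1 `&` cyl t.2 m) t.1 j a.2).
have := @all_tasks _ _ le good [seq (b, y) | b <- s, y <- r] (P, C).
case.
- move=> a; split => //; split => //; first by move=> x ax; exists x.
  exact: ext_refl.
- move=> a c d [h1 [h2 h3 h4]] [g1 [g2 g3 g4]]; split; first by move=> /g1.
  split; first exact: subset_trans g2.
    move=> x /g3 [y cy xy]; have [z az yz] := h3 y cy; exists z => //.
    exact: agree_trans yz.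
  move=> hd; have e := g4 hd; have [hc _ _] := e.
  exact: (ext_trans hk hH hd (h4 hc) e).
- move=> t a c [h1 [h2 h3 h4]] [hc g]; have e := h4 hc; split; first by case: e.
  move=> [x ax tx]; apply: (decided_mono hc _ _ e); first by apply: g; exists x => //; exact: h2.
  by apply: setSI.
- move=> [b y] [P1 C1] _ [/(_ pP) /= pP1 [_ _ /(_ hC) [hC1 _ _]]].
  have [P2 [C2 [p2 s2 e2 m2 d2]]] := decide_one m y b j pP1 hC1.
  by exists (P2, C2); split => //=; case: e2.
move=> [P' C'] [/(_ pP) /= pP' [P'P hm /(_ hC) /= e]] g; exists P', C'; split => // b x P'x.
case: (pselect (exists D, [/\ H D, below_at k (size b) D j C' & restr (size b) D = b]))
    => [[D [hD bD rD]]|nD]; last first.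
  by left => D hD bD rD; exfalso; apply: nD; exists D.
have bs : b \in s.
  rewrite -rD; apply: hs; first exact: (coideal_inf hH hD).
  exact: (below_at_ext hk hH hC e).
have [y yr xy] := hr x.
have [|_ d] := g (b, y); first by apply/allpairsP; exists (b, y).
by rewrite (cyl_eq xy); apply: d; exists x => //; exact: agreeC.
Qed.

Lemma depth_geq i D j C j0 : FINinf k C -> below_at k i D j C -> j0 <= i ->
  (forall l, l < j0 -> D l = C l) -> j0 <= j.
Proof.
move=> hC bD ji a; rewrite leqNgt; apply/negP => jj.
have := below_at_lt hk hC bD (leq_trans jj ji); rewrite a // => h.
have [t _ ht] := FIN_top hk (FINinf_FIN j hC).
by have := h t t ht ht; rewrite ltnn.
Qed.

(** A fusion whose states are a perfect set and a level: round j decides all stems of depth j on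
    every cylinder of the current level. *)
Theorem decision A P j0 : H A -> perfect P -> exists S B (N : fseq -> nat),
  [/\ perfect S, S `<=` P, ext j0 B A &
   forall b x, j0 <= size b -> S x ->
   (forall D, ext j0 D B -> restr (size b) D = b ->
      Phi (S `&` cyl x (N b)) (size b) D) \/
   (forall D, ext j0 D B -> restr (size b) D = b ->
      refutes (S `&` cyl x (N b)) (size b) D)].
Proof.
move=> hA pP.
pose W := (set cantor_space * nat)%type.
pose R j (w : W) C (w' : W) := [/\ w'.1 `<=` w.1, perfect w'.1, w.2 < w'.2,
  (forall x, w.1 x -> exists y z, [/\ w'.1 y, w'.1 z, agree w.2 x y, agree w.2 x z &
     ~ agree w'.2 y z]) &
  forall b x, w'.1 x -> decided (w'.1 `&` cyl x w.2) b j C].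
have [||||B [w [eB w0 hw]]] := @semiselective_strategy k hk H hH hsemi W R
  (fun _ w _ => perfect w.1) A j0 (P, 0) hA.
- move=> j v C C' v' hC [h1 h2 h3 h4 h5] e; split => // b x /h5 d.
  exact: (decided_mono hC (d b) _ e).
- move=> j v C _ [hC _ _] pv.
  have [P' [C' [p1 p2 p3 p4 p5]]] := decide_all v.2 j pv hC.
  have [M mM hM] := perfect_split v.2 p1.
  exists C', (P', M); split => //; split => //= x /p4 [x' P'x' xx'].
  have [y [z [h1 h2 h3 h4 h5]]] := hM x' P'x'.
  by exists y, z; split => //; exact: agree_trans xx' _.
- by move=> j v C v' _ _ [].
- by [].
pose Pj j := (w (j0 + j)).1; pose Mj j := (w (j0 + j)).2.
have hR j : R (j0 + j) (w (j0 + j)) B (w (j0 + j.+1)).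
  by rewrite addnS; apply: hw; exact: leq_addr.
have pPj j : perfect (Pj j).
  case: j => [|j]; first by rewrite /Pj addn0 w0.
  by have [] := hR j.
have pS : perfect (\bigcap_j Pj j).
  apply: (@perfect_fusion _ Mj).
  - by case: (pPj 0).
  - by move=> j; have /perfectE [] := pPj j.
  - by move=> j; have [] := hR j.
  - by move=> j; have [] := hR j.
  - by move=> j; have [] := hR j.
have SP : \bigcap_j Pj j `<=` P.
  by move=> x /(_ 0 I); rewrite /Pj addn0 w0.
have fB : FINinf k B by case: eB => /(coideal_inf hH).
suff /choice [N hN] : forall b, exists n, forall x, j0 <= size b -> (\bigcap_j Pj j) x ->
   (forall D, ext j0 D B -> restr (size b) D = b ->
      Phi (\bigcap_j Pj j `&` cyl x n) (size b) D) \/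
   (forall D, ext j0 D B -> restr (size b) D = b ->
      refutes (\bigcap_j Pj j `&` cyl x n) (size b) D).
  by exists (\bigcap_j Pj j), B, N.
move=> b; case: (pselect (exists2 D, ext j0 D B & restr (size b) D = b)) => [[D eD rD]|nD]; last first.
  by exists 0 => x _ _; left => D eD rD; exfalso; apply: nD; exists D.
have [hD DB aD] := eD; have fD := coideal_inf hH hD.
have [j [hj _]] := below_at_ex hk (size b) fD fB DB.
(* The level in force at round j, where j is the depth of b in B. *)
exists (Mj (j - j0)) => x jb Sx.
have jj : j0 <= j by apply: (depth_geq fB (hj D fD DB _) jb).
have bel D' : ext j0 D' B -> restr (size b) D' = b -> below_at k (size b) D' (j0 + (j - j0)) B.
  move=> [hD' D'B _] rD'; rewrite subnKC //; apply: hj => //; first exact: (coideal_inf hH hD').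
  by apply/restrP; rewrite rD rD'.
have sub : \bigcap_j Pj j `&` cyl x (Mj (j - j0)) `<=`
    Pj (j - j0).+1 `&` cyl x (Mj (j - j0)) by apply: setSI => y; exact.
have [_ _ _ _ /(_ b x (Sx (j - j0).+1 I)) d] := hR (j - j0).
case: d => d; [left|right] => D' eD' rD'.
  have [hD' _ _] := eD'.
  by apply: (Phi_mono hD' (d D' hD' _ rD') sub (ext_refl hk hH _ hD')); exact: bel.
have [hD' _ _] := eD'.
by apply: (refutes_mono hD' (d D' hD' _ rD') sub (ext_refl hk hH _ hD')); exact: bel.
Qed.

End Decision.

(** * A pigeonhole principle with perfect parameters *)

Section ParametrizedPigeonhole.
Variables (k : nat) (hk : 0 < k) (H : set iseq) (hH : coideal k H).
Hypothesis hsemi : semiselective k H.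
Variable j0 : nat.
Local Notation ext := (ext k H).

Section OneColour.
Variables (f : cantor_space -> fseq -> Prop) (N : fseq -> nat).
Hypothesis f_loc : forall x y b, agree (N b) x y -> f x b -> f y b.

Definition good x D : Prop := forall E, ext j0 E D -> f x (restr j0.+1 E).

Lemma good_mono x j D D' : j0 <= j -> H D -> ext j D' D -> good x D -> good x D'.
Proof.
move=> jj hD e g E eE; apply: g; apply: (ext_trans hk hH hD eE); exact: extW e.
Qed.

Let never (Q : set cantor_space) i D := forall x, Q x -> forall D', ext i D' D -> ~ good x D'.

Let never_mono P P' i D D' : H D -> never P i D -> P' `<=` P ->
  ext i D' D -> never P' i D'.
Proof.
move=> hD n PP e x /PP Px E eE; apply: (n x Px).
exact: (ext_trans hk hH hD eE).
Qed.

(** The fusion keeps a finite list of good points. Each round replaces every point by two nearby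
    ones, good for a smaller condition, and raises the level above [N] of the stems settled then;
    [f_loc] passes the colour from the kept points to their limits. *)
Lemma dense_good_homogeneous A P : H A -> perfect P ->
  (forall P' D, perfect P' -> P' `<=` P -> ext j0 D A ->
     exists x D', [/\ P' x, ext j0 D' D & good x D']) ->
  exists S B, [/\ perfect S, S `<=` P, ext j0 B A & forall x, S x -> good x B].
Proof.
move=> hA pP dense.
(* The hypothesis [dense] finds good points by refinements that keep only [j0] blocks. Deciding
   [never] provides, around a kept point, refinements that keep all blocks fixed so far. *)
have [S2 [B2 [N2 [pS2 S2P eB2 dec]]]] := decision hk hH hsemi never_mono j0 hA pP.
have [x0 [A2 [S2x0 eA2 g0]]] := dense S2 B2 pS2 S2P eB2.
have hB2 : H B2 by case: eB2.
have hA2 : H A2 by case: eA2.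
pose W := (seq cantor_space * nat)%type.
pose R j (v : W) C (v' : W) := [/\ j0 <= j, v.2 < v'.2,
   forall E, H E -> below_at k j0.+1 E j C -> N (restr j0.+1 E) <= v'.2 &
   {in v.1 &, forall y z, y <> z -> ~ agree v'.2 y z}] /\
  [/\ {in v.1, forall x, S2 x /\ good x C},
   {in v.1, forall x, exists y z, [/\ y \in v'.1, z \in v'.1, y <> z,
      agree v'.2 x y & agree v'.2 x z]},
   {in v'.1, forall y, exists2 x, x \in v.1 & agree v'.2 x y} &
   {in v'.1, forall y, S2 y /\ good y C}].
pose Inv (j : nat) (v : W) C := {in v.1, forall x, S2 x /\ good x C}.
have R_dense j v C : j0 <= j -> ext j0 C A2 -> Inv j v C ->
    exists C' v', ext j C' C /\ R j v C' v'.
  move=> jj eC Iv; have [hC _ _] := eC.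
  have eCB : ext j0 C B2 by exact: (ext_trans hk hH hB2 eC).
  have [s hs] := finite_below hk j (coideal_inf hH hC).
  have sepP (p : cantor_space * cantor_space) : exists n, p.1 <> p.2 -> ~ agree n p.1 p.2.
    case: (pselect (p.1 = p.2)) => [e|/neq_agree [n hn]]; last by exists n.
    by exists 0 => /(_ e).
  have [sep hsep] := choice sepP.
  have [M [M1 M2 M3 M4]] : exists M, [/\ v.2 < M, N2 (restr j C) <= M,
      \max_(b <- s) N b <= M &
      \max_(p <- [seq (y, z) | y <- v.1, z <- v.1]) sep p <= M].
    exists (v.2.+1 + N2 (restr j C) + \max_(b <- s) N b +
      \max_(p <- [seq (y, z) | y <- v.1, z <- v.1]) sep p); split; lia.
  have points (l : seq cantor_space) : {in l, forall x, S2 x /\ good x C} ->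
      exists (F : seq cantor_space) C', [/\ ext j C' C,
      {in l, forall x, exists y z, [/\ y \in F, z \in F, y <> z, agree M x y & agree M x z]},
      {in F, forall y, exists2 x, x \in l & agree M x y} &
      {in F, forall y, S2 y /\ good y C'}].
    elim: l => [_|x l IH Il].
      by exists [::], C; split => //; exact: ext_refl.
    have [|F [C1 [e1 h1 h2 h3]]] := IH.
      by move=> y yl; apply: Il; rewrite inE yl orbT.
    have hC1 : H C1 by case: e1.
    have [S2x gx] := Il x (mem_head _ _).
    (* The point x is itself good for C, so [never] cannot hold there and must be refuted. *)
    have rj : refutes k H never (S2 `&` cyl x (N2 (restr j C))) j C.
      have [||d|d] := dec (restr j C) x; rewrite ?size_restr //.
        exfalso; rewrite size_restr in d.
        by apply: (d C eCB erefl x _ C) => //; exact: ext_refl.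
      by rewrite size_restr in d; exact: d.
    have pQ := perfect_cyl M pS2 S2x.
    have QN : S2 `&` cyl x M `<=` S2 `&` cyl x (N2 (restr j C)).
      by move=> y [S2y xy]; split => //; exact: agreeW xy.
    have find Q D : perfect Q -> Q `<=` S2 `&` cyl x M -> ext j D C ->
        exists y D', [/\ Q y, ext j D' D & good y D'].
      move=> pQ' QQ eD; apply: contrapT => no.
      apply: (rj Q D pQ' (subset_trans QQ QN) eD) => y Qy D' eD' gy.
      by apply: no; exists y, D'.
    have [y [D [[S2y xy] eD gy]]] := find _ C1 pQ (fun _ h => h) e1.
    have [hD _ _] := eD; have eDC : ext j D C by exact: (ext_trans hk hH hC eD).
    have [_ _ lim] := iffLR (perfectE _) pQ.
    (* A second point t of the perfect set has a cylinder excluding y; the good point z found in it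
       differs from y. *)
    have [t [Qt _ ty]] := lim y 0 (conj S2y xy); have [n hn] := neq_agree ty.
    have [z [D' [[[S2z xz] tz] eD' gz]]] := find _ D (perfect_cyl n pQ Qt)
      (fun _ h => h.1) eDC.
    have yz : y <> z by move=> e; apply: hn; rewrite e.
    have eD'1 : ext j D' C1 by exact: (ext_trans hk hH hC1 eD').
    exists [:: y, z & F], D'; split.
    - exact: (ext_trans hk hH hC eD'1).
    - move=> u; rewrite inE => /predU1P[->|ul].
        by exists y, z; split => //; rewrite !inE eqxx ?orbT.
      have [p [q [hp hq pq up uq]]] := h1 u ul.
      by exists p, q; split => //; rewrite !inE ?hp ?hq !orbT.
    - move=> u; rewrite !inE => /or3P[/eqP->|/eqP->|/h2 [p pl pu]].
      + by exists x => //; exact: mem_head.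
      + by exists x => //; exact: mem_head.
      + by exists p => //; rewrite inE pl orbT.
    - move=> u; rewrite !inE => /or3P[/eqP->|/eqP->|/h3 [S2u gu]]; split => //.
        exact: (good_mono jj hD eD').
      exact: (good_mono jj hC1 eD'1).
  have [F [C' [eC' h1 h2 h3]]] := points _ Iv.
  exists C', (F, M); split => //; split; split => //=.
  - move=> E hE bE; have Es : restr j0.+1 E \in s.
      apply: hs; first exact: (coideal_inf hH hE).
      exact: (below_at_ext hk hH hC eC').
    by exact: leq_trans (@leq_bigmax_seq _ s predT N _ Es isT) M3.
  - move=> y z yF zF yz h; apply: (hsep (y, z) yz); apply: agreeW h => /=.
    have ps : (y, z) \in [seq (y, z) | y <- v.1, z <- v.1] by apply/allpairsP; exists (y, z).
    by exact: leq_trans (@leq_bigmax_seq _ _ predT sep _ ps isT) M4.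
  - move=> x xv; have [S2x gx] := Iv x xv; split => //.
    exact: (good_mono jj hC eC').
have [||||B [w [eB w0 hw]]] := @semiselective_strategy k hk H hH hsemi W R
  Inv A2 j0 ([:: x0], 0) hA2.
- move=> j v C C' v' hC [[a1 a2 a3 a4] [b1 b2 b3 b4]] e; split; split => //.
  + by move=> E hE bE; apply: a3 => //; exact: (below_at_ext hk hH hC e).
  + by move=> x /b1 [h1 h2]; split => //; exact: (good_mono a1 hC e).
  + by move=> x /b4 [h1 h2]; split => //; exact: (good_mono a1 hC e).
- exact: R_dense.
- by move=> j v C v' _ _ [_ []].
- move=> C eC x; rewrite inE => /eqP ->; split => //.
  exact: (good_mono (leqnn j0) hA2 eC).
(* [M] is read one round later than [F]: the level chosen in round [j0 + j] separates the points of
   [F j] and bounds [N] on the stems of that depth. *)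
pose F j := (w (j0 + j)).1; pose M j := (w (j0 + j).+1).2.
have hR j : R (j0 + j) (w (j0 + j)) B (w (j0 + j).+1) by apply: hw; exact: leq_addr.
have hF j : {in F j, forall x, S2 x /\ good x B} by have [_ []] := hR j.
pose Q j : set cantor_space := S2 `&` [set t | exists2 x, x \in F j & agree (M j) x t].
have MS j : M j < M j.+1 by have [[_ + _ _] _] := hR j.+1; rewrite /M addnS.
have hB : H B by case: eB.
exists (\bigcap_j Q j), B; split.
- apply: (@perfect_fusion Q M) => //.
  + by exists x0; split => //; exists x0; rewrite // /F addn0 w0 mem_head.
  + move=> j; have /perfectE [_ cS _] := pS2; move=> y h; split.
      by apply: cS => n; have [z []] := h n; exists z.
    have [z [_ [x xF xz]] yz] := h (M j); exists x => //.
    by apply: agree_trans xz _; exact: agreeC.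
  + move=> j t [S2t [y yF yt]]; split => //; have [_ [_ _ h _]] := hR j.
    rewrite /F addnS in yF; have [x xF xy] := h y yF; exists x => //.
    by apply: agree_trans xy _; apply: agreeW yt; exact: ltnW (MS j).
  + move=> j t [S2t [x xF xt]]; have [_ [_ h _ _]] := hR j.
    have [y [z [yF zF yz xy xz]]] := h x xF.
    have yF' : y \in F j.+1 by rewrite /F addnS.
    have zF' : z \in F j.+1 by rewrite /F addnS.
    exists y, z; split.
    * by split; [case: (hF _ _ yF')|exists y].
    * by split; [case: (hF _ _ zF')|exists z].
    * by apply: agree_trans xy; exact: agreeC.
    * by apply: agree_trans xz; exact: agreeC.
    * by have [[_ _ _ +] _] := hR j.+1; apply.
- by move=> x /(_ 0 I) [/S2P].
- by apply: (ext_trans hk hH hA _ eB2); exact: (ext_trans hk hH hB2 eB).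
move=> x Sx E eE; have [hE EB aE] := eE; have fB := coideal_inf hH hB; have fE := coideal_inf hH hE.
have [j [hj _]] := below_at_ex hk j0.+1 fE fB EB; have bE := hj E fE EB (fun _ _ => erefl).
have jj : j0 <= j by exact: (depth_geq hk fB bE (leqnSn j0) aE).
have [_ [y yF yx]] := Sx (j - j0) I.
have [_ gy] := hF _ y yF; apply: (f_loc _ (gy E eE)); apply: agreeW yx.
by have [[_ _ h _] _] := hR (j - j0); apply: h => //; rewrite subnKC.
Qed.

End OneColour.

(** If good points for f are not dense, some pair has none below it; there [one_block_pigeonhole],
    applied at single points, makes good points for the complementary colour dense. *)
Theorem parametrized_pigeonhole (f : cantor_space -> fseq -> Prop) (N : fseq -> nat) A P :
  (forall x y b, agree (N b) x y -> f x b -> f y b) -> H A -> perfect P ->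
  exists S B, [/\ perfect S, S `<=` P, ext j0 B A &
    (forall x D, S x -> ext j0 D B -> f x (restr j0.+1 D)) \/
    (forall x D, S x -> ext j0 D B -> ~ f x (restr j0.+1 D))].
Proof.
move=> f_loc hA pP.
case: (pselect (forall P' D, perfect P' -> P' `<=` P -> ext j0 D A ->
     exists x D', [/\ P' x, ext j0 D' D & good f x D'])) => [h|].
  have [S [B [h1 h2 h3 h4]]] := dense_good_homogeneous f_loc hA pP h.
  by exists S, B; split => //; left => x D /h4; exact.
move=> /existsNP [P1 /existsNP [A1 /not_implyP [pP1 /not_implyP [P1P /not_implyP [eA1 no]]]]].
have hA1 : H A1 by case: eA1.
have nf_loc x y b : agree (N b) x y -> ~ f x b -> ~ f y b.
  by move=> /agreeC xy n /(f_loc _ _ _ xy).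
have [|S [B [h1 h2 h3 h4]]] := dense_good_homogeneous nf_loc hA1 pP1.
  move=> P' D [pP' [x P'x]] P'P1 eD; have hD : H D by case: eD.
  have [D' eD' [fD|fD]] := one_block_pigeonhole hk hH j0 (fun b => f x b) hD; last by exists x, D'.
  exfalso; apply: no; exists x, D'; split => //; first exact: P'P1.
  exact: (ext_trans hk hH hA1 eD').
exists S, B; split => //; first exact: subset_trans P1P.
  exact: (ext_trans hk hH hA h3).
by right => x D /h4; exact.
Qed.

End ParametrizedPigeonhole.

(** * Acceptance and rejection *)

Section Forcing.
Variables (k : nat) (hk : 0 < k) (H : set iseq) (hH : coideal k H).
Hypothesis hsemi : semiselective k H.
Local Notation ext := (ext k H).
Implicit Types (X : set (cantor_space * iseq)) (P Q S : set cantor_space).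

Definition accepts X P i D : Prop := forall x Y, P x -> FINinf k Y -> ile k Y D ->
  (forall l, l < i -> Y l = D l) -> X (x, Y).

Lemma accepts_mono X P P' i D D' : H D -> accepts X P i D -> P' `<=` P ->
  ext i D' D -> accepts X P' i D'.
Proof.
move=> hD a PP [hD' D'D e] x Y P'x fY YD' eY; apply: a => //; first exact: PP.
  exact: (ile_trans hk fY (coideal_inf hH hD') (coideal_inf hH hD) YD' D'D).
by move=> l li; rewrite eY // e.
Qed.

Definition rejects X := refutes k H (accepts X).

Section Fixed.
Variable X : set (cantor_space * iseq).

Let rejects_mono P P' i D D' : H D -> rejects X P i D -> P' `<=` P ->
  ext i D' D -> rejects X P' i D'.
Proof. exact: (refutes_mono hk hH). Qed.

(** An accepting perfect subset would have a perfect part in the cylinder of one of its points, and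
    that part would accept too. *)
Let rejects_local S N i D : (forall x, S x -> rejects X (S `&` cyl x (N x)) i D) ->
  rejects X S i D.
Proof.
move=> h P' D' pP' P'S eD' a; have [_ [x P'x]] := pP'.
apply: (h x (P'S x P'x) (P' `&` cyl x (N x)) D') => //; first exact: perfect_cyl.
  exact: setSI.
by move=> y Y [P'y _]; exact: a.
Qed.

(** One-block extensions are coloured at x by acceptance near x. Were all of them accepted, the stem
    of length j would be accepted as well, since every Y continuing it continues one of them. *)
Lemma rejects_step P j C : perfect P -> H C -> rejects X P j C ->
  exists P' C', [/\ perfect P', P' `<=` P, ext j C' C &
    forall D, ext j D C' -> rejects X P' j.+1 D].
Proof.
move=> pP hC rP.
have [S [B [N [pS SP eB dec]]]] := decision hk hH hsemi (@accepts_mono X) j hC pP.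
have hB : H B by case: eB.
pose f (x : cantor_space) (b : fseq) := forall D, ext j D B -> restr j.+1 D = b ->
  accepts X (S `&` cyl x (N b)) j.+1 D.
have f_loc x y b : agree (N b) x y -> f x b -> f y b.
  by move=> xy fx D eD rD; rewrite -(cyl_eq xy); exact: fx.
have [S' [B' [pS' S'S eB' hom]]] := parametrized_pigeonhole hk hH hsemi j f_loc hB pS.
have hB' : H B' by case: eB'.
exists S', B'; split => //; first exact: subset_trans SP.
  exact: (ext_trans hk hH hC eB').
case: hom => hom.
  exfalso; apply: (rP S' B' pS' (subset_trans S'S SP)) => //.
    exact: (ext_trans hk hH hC eB').
  move=> x Y S'x fY YB' aY.
  have [n [hn _]] := below_at_ex hk j.+1 fY (coideal_inf hH hB') YB'.
  have bY := hn Y fY YB' (fun _ _ => erefl).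
  have hE := coideal_below_splice hk hH hB' fY bY; set E := splice _ _ _ _ in hE.
  have eE : ext j E B'.
    split => //; first exact: (below_at_splice_ile hk (coideal_inf hH hB') bY).
    by move=> l lj; rewrite /E splice_lo ?aY // ltnW.
  apply: (hom x E S'x eE E (ext_trans hk hH hB eE eB') erefl) => //.
  - by split => //; exact: S'S.
  - by apply: (below_at_ile hk (coideal_inf hH hB')) => //; exact: coideal_inf hH _ hE.
  - by move=> l lj; rewrite /E splice_lo.
move=> D eD; have eDB := ext_trans hk hH hB eD eB'.
apply: (rejects_local (N := fun=> N (restr j.+1 D))) => x S'x.
have [||d|d] := dec (restr j.+1 D) x; rewrite ?size_restr //; first exact: S'S.
  by exfalso; apply: (hom x D S'x eD) => E eE rE; have := d E eE; rewrite size_restr; exact.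
have := d D eDB; rewrite size_restr => /(_ erefl) r.
have hD : H D by case: eD.
apply: (rejects_mono hD r); last exact: (ext_refl hk hH).
exact: setSI.
Qed.

Lemma rejects_all P j0 A : perfect P -> H A -> rejects X P j0 A ->
  exists S B, [/\ perfect S, S `<=` P, ext j0 B A &
    forall i D, j0 <= i -> ext j0 D B -> rejects X S i D].
Proof.
move=> pP hA rP.
(* No pair on a perfect set refutes this property: below a rejecting pair [rejects_step] gives the
   second alternative, and any other pair has an accepting one below it. So [decision] yields the
   property, and rejection climbs from length i to i+1. *)
pose Phi Q i D := accepts X Q i D \/ forall E, ext i E D -> rejects X Q i.+1 E.
have Phi_mono Q Q' i D D' : H D -> Phi Q i D -> Q' `<=` Q -> ext i D' D -> Phi Q' i D'.
  move=> hD [a|r] QQ e; [left|right]; first exact: (accepts_mono hD a).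
  move=> E eE; have eED := ext_trans hk hH hD eE e.
  have hE : H E by case: eE.
  by apply: (rejects_mono hE (r E eED) QQ); exact: (ext_refl hk hH).
have [S [B [N [pS SP eB dec]]]] := decision hk hH hsemi Phi_mono j0 hA pP.
exists S, B; split => // i D ji; elim: i ji D => [|i IH] ji D eD.
  move: ji; rewrite leqn0 => /eqP j0E; subst j0.
  by apply: (rejects_mono hA rP SP); exact: (ext_trans hk hH hA eD).
have [e|ji'] := eqVneq j0 i.+1.
  rewrite -e; apply: (rejects_mono hA rP SP); exact: (ext_trans hk hH hA eD).
have {ji' ji}ji : j0 <= i by rewrite -ltnS ltn_neqAle ji'.
have hD : H D by case: eD.
apply: (rejects_local (N := fun=> N (restr i D))) => x Sx.
have [||d|d] := dec (restr i D) x; rewrite ?size_restr //.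
  have := d D eD; rewrite size_restr => /(_ erefl) [a|]; last by apply; exact: (ext_refl hk hH).
  exfalso; apply: (IH ji D eD (S `&` cyl x (N (restr i D))) D) => //.
  - exact: perfect_cyl.
  - exact: (ext_refl hk hH).
have := d D eD; rewrite size_restr => /(_ erefl) r; exfalso.
have pQ := perfect_cyl (N (restr i D)) pS Sx.
case: (pselect (rejects X (S `&` cyl x (N (restr i D))) i D)) => [rQ|].
  have [P' [C' [p1 p2 p3 p4]]] := rejects_step pQ hD rQ.
  by apply: (r P' C') => //; right.
move=> /existsNP [P' /existsNP [D' /not_implyP [p1 /not_implyP [p2 /not_implyP [p3 /contrapT p4]]]]].
by apply: (r P' D') => //; left.
Qed.

End Fixed.

Lemma accepts_or_rejects X P j A : perfect P -> H A ->
  exists S B, [/\ perfect S, S `<=` P, ext j B A &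
    accepts X S j B \/ forall i D, j <= i -> ext j D B -> rejects X S i D].
Proof.
move=> pP hA; case: (pselect (rejects X P j A)) => [rP|].
  have [S [B [h1 h2 h3 h4]]] := rejects_all pP hA rP.
  by exists S, B; split => //; right.
move=> /existsNP [P' /existsNP [D' /not_implyP [p1 /not_implyP [p2 /not_implyP [p3 /contrapT p4]]]]].
by exists P', D'; split => //; left.
Qed.

Lemma accepts_basic X S a B : FINinf k B -> restr (size a) B = a ->
  accepts X S (size a) B -> S `*` basic k a B `<=` X.
Proof.
move=> fB aB h [x Y] [/= Sx /basicE [fY aY YB]]; apply: h => //.
by apply/restrP; rewrite aY.
Qed.

(** Putting b in front of a tail of B gives a condition of H inside the box, so a box from the Baire
    property becomes an acceptance. *)
Lemma box_accepts X S j B0 b B : H B0 -> H B -> basic k b B !=set0 ->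
  basic k b B `<=` basic k (restr j B0) B0 -> S `*` basic k b B `<=` X ->
  exists i E, [/\ j <= i, ext j E B0 & accepts X S i E].
Proof.
move=> hB0 hB [Y bY] sub SX; have /basicE [fY rY YB] := bY.
have fB := coideal_inf hH hB.
have [n [hn _]] := below_at_ex hk (size b) fY fB YB.
have bel := hn Y fY YB (fun _ _ => erefl).
have hE := coideal_below_splice hk hH hB fY bel; set E := splice _ _ _ _ in hE.
have EB : ile k E B := below_at_splice_ile hk fB bel.
have rE : restr (size b) E = b.
  by rewrite -[RHS]rY; apply/restrP => l lb; rewrite /E splice_lo.
have bE : basic k b B E by apply/basicE; split => //; exact: coideal_inf hH _ hE.
have /basicE [_ aE EB0] := sub _ bE; rewrite size_restr in aE.
(* The stem must have length at least j and must also determine b. *)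
exists (maxn (size b) j), E; split; first exact: leq_maxr.
  by split => //; exact/restrP.
move=> x Z Sx fZ ZE eZ; apply: SX; split => //=; apply/basicE; split => //.
  rewrite -[RHS]rE; apply/restrP => l lb; apply: eZ; apply: leq_trans lb _; exact: leq_maxl.
exact: (ile_trans hk fZ (coideal_inf hH hE) fB ZE EB).
Qed.

(** A member of [a, A] may lie outside H, but a followed by a suitable tail of A belongs to H. *)
Lemma basic_stem a A : H A -> basic k a A !=set0 -> exists B,
  [/\ H B, restr (size a) B = a & ile k B A].
Proof.
move=> hA [Y /basicE [fY aY YA]]; have fA := coideal_inf hH hA.
have [n [hn _]] := below_at_ex hk (size a) fY fA YA.
have bel := hn Y fY YA (fun _ _ => erefl).
exists (splice (size a) Y n A); split; first exact: (coideal_below_splice hk hH hA fY).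
  by rewrite -[RHS]aY; apply/restrP => l la; rewrite splice_lo.
exact: (below_at_splice_ile hk fA bel).
Qed.

Lemma basic_trans a A B : H A -> basic k a A B -> basic k a B `<=` basic k a A.
Proof.
move=> hA /basicE [fB _ BA] Y /basicE [fY aY YB]; apply/basicE; split => //.
exact: (ile_trans hk fY fB (coideal_inf hH hA) YB BA).
Qed.

Lemma rejects_no_box X S j B : H B ->
  (forall i D, j <= i -> ext j D B -> rejects X S i D) ->
  forall S' b B', perfect S' -> S' `<=` S -> H B' -> basic k b B' !=set0 ->
  basic k b B' `<=` basic k (restr j B) B -> ~ (S' `*` basic k b B' `<=` X).
Proof.
move=> hB rej S' b B' pS' S'S hB' b0 sub SX.
have [i [E [ji eE a]]] := box_accepts hB hB' b0 sub SX.
have hE : H E by case: eE.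
by apply: (rej i E ji eE S' E pS' S'S _ a); exact: (ext_refl hk hH).
Qed.

End Forcing.

(** * Equivalence of the Ramsey and Baire properties *)

Theorem theorem6p3 (k : nat) (hk : 0 < k) (H : set iseq)
    (hH : coideal k H) (hsemi : semiselective k H) :
  (forall X : set (cantor_space * iseq), X `<=` setT `*` FINinf k ->
     (pramsey k H X <-> pbaire k H X)) /\
  (forall X : set (cantor_space * iseq), X `<=` setT `*` FINinf k ->
     (pramsey_null k H X <-> pmeager k H X)).
Proof.
have self a A B : basic k a A B -> basic k a B B.
  by move=> /basicE [fB aB _]; apply/basicE; split => //; exact: ile_refl.
have stem a A C B : H A -> H C -> restr (size a) C = a -> ile k C A ->
    ext k H (size a) B C -> restr (size a) B = a /\ (basic k a A `&` H) B.
  move=> hA hC aC CA [hB BC /restrP aB]; rewrite aC in aB; split => //; split => //.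
  apply/basicE; split => //; first exact: (coideal_inf hH hB).
  exact: (ile_trans hk (coideal_inf hH hB) (coideal_inf hH hC) (coideal_inf hH hA) BC CA).
split => X _; split => R Q a A pQ fa hA a0.
- have [S [B [pS SQ [aB hB] SX]]] := R Q a A pQ fa hA a0.
  by exists S, a, B; split => //; [exists B; exact: self aB|exact: (basic_trans hk hH)].
- have [A1 [hA1 aA1 A1A]] := basic_stem hk hH hA a0.
  have [S1 [B1 [pS1 S1Q eB1 d1]]] := accepts_or_rejects hk hH hsemi X (size a) pQ hA1.
  have hB1 : H B1 by case: eB1.
  case: d1 => d1.
    have [rB1 bB1] := stem a A A1 B1 hA hA1 aA1 A1A eB1.
    by exists S1, B1; split => //; left; exact: (accepts_basic (coideal_inf hH hB1) rB1).
  (* X is now rejected with every stem extending a, so the complement is tried below this pair. *)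
  have [S2 [B2 [pS2 S2S1 eB2 d2]]] := accepts_or_rejects hk hH hsemi (~` X) (size a) pS1 hB1.
  have hB2 : H B2 by case: eB2.
  have eB21 := ext_trans hk hH hA1 eB2 eB1.
  have [rB2 bB2] := stem a A A1 B2 hA hA1 aA1 A1A eB21.
  case: d2 => d2.
    exists S2, B2; split => //; first exact: subset_trans S1Q.
    by right; apply/disjoints_subset; exact: (accepts_basic (coideal_inf hH hB2) rB2).
  have {}d1 i D : size a <= i -> ext k H (size a) D B2 -> rejects k H X S2 i D.
    move=> ai eD; have eD1 := ext_trans hk hH hB1 eD eB2; have hD : H D by case: eD.
    apply: (refutes_mono hk hH hD (d1 i D ai eD1) S2S1); exact: (ext_refl hk hH).
  (* The box supplied here lies in X or in its complement, and both are rejected. *)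
  have [|S' [b [B' [[pS' S'S] [fb hB'] b0 sub]]]] := R S2 a B2 pS2 fa hB2.
    by exists B2; apply: self; case: bB2 => h _; exact: h.
  rewrite -rB2 in sub; case=> [/(rejects_no_box hk hH hB2 d1 pS' S'S hB' b0 sub)//|].
  by move=> /disjoints_subset /(rejects_no_box hk hH hB2 d2 pS' S'S hB' b0 sub).
- have [S [B [pS SQ [aB hB] SX]]] := R Q a A pQ fa hA a0.
  by exists S, a, B; split => //; [exists B; exact: self aB|exact: (basic_trans hk hH)].
have [A1 [hA1 aA1 A1A]] := basic_stem hk hH hA a0.
(* Boxes from meagerness always miss X, so it suffices to treat the complement. *)
have [S1 [B1 [pS1 S1Q eB1 d1]]] := accepts_or_rejects hk hH hsemi (~` X) (size a) pQ hA1.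
have hB1 : H B1 by case: eB1.
have [rB1 bB1] := stem a A A1 B1 hA hA1 aA1 A1A eB1.
exists S1, B1; split => //; case: d1 => d1.
  by apply/disjoints_subset; exact: (accepts_basic (coideal_inf hH hB1) rB1).
have [|S' [b [B' [[pS' S'S] [fb hB'] b0 sub]]]] := R S1 a B1 pS1 fa hB1.
  by exists B1; apply: self; case: bB1 => h _; exact: h.
rewrite -rB1 in sub.
by move=> /disjoints_subset /(rejects_no_box hk hH hB1 d1 pS' S'S hB' b0 sub).
Qed.
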